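(* Let $0<|q|<1$ and let $a,b,s,t$ be nonzero complex numbers with $\left|\frac{a^2}{bst}\right|<1$, such that no denominator below vanishes. Then \[ \sum_{n=-\infty}^{\infty}\frac{(aq^2,-aq^2,b;q^2)_n\,(s,t;q)_n}{(a,-a,a^2q^2/b;q^2)_n\,(aq/s,aq/t;q)_n}\left(-\frac{a^2}{bst}\right)^n =\frac{a(s+t)}{(a+1)st}\,\frac{(q,q/a,aq,aq/(st),-a/b;q)_\infty\,(a^2q^2/(bs^2),a^2q^2/(bt^2);q^2)_\infty}{(q/s,q/t,aq/s,aq/t,-a^2/(bst);q)_\infty\,(a^2q^2/b,q^2/b;q^2)_\infty}. \]
   Context: For $0<|q|<1$: $(x;q)_\infty=\prod_{i=0}^{\infty}(1-xq^i)$ and $(x;q)_n=(x;q)_\infty/(xq^n;q)_\infty$ for any integer $n$ (including negative $n$). Also $(x_1,\dots,x_r;q)_k=(x_1;q)_k\cdots(x_r;q)_k$ for $k$ an integer or $\infty$. *)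

(* Defs.v *)
From mathcomp Require Import all_boot all_order all_algebra.
From mathcomp Require Import complex.
From mathcomp Require Import all_classical all_reals all_analysis.

Set Implicit Arguments.
Unset Strict Implicit.
Unset Printing Implicit Defensive.

Import Order.TTheory GRing.Theory Num.Theory.
Import numFieldNormedType.Exports.

Local Open Scope classical_set_scope.
Local Open Scope ring_scope.

Definition qpoch_inf (K : numFieldType) (x q : K) : K :=
  lim ((fun n : nat => \prod_(i < n) (1 - x * q ^+ i)) @ \oo).

(* The quotient (x;q)_oo / (x q^n;q)_oo after cancelling common factors, so
   that it keeps its usual value when x is a nonpositive power of q and the
   quotient reads 0/0; qpochE below is the quotient formula.  For n < 0 the
   value is the inverse of a product, so 1/(x;q)_n is that product even when it
   vanishes. *)
Definition qpoch (K : numFieldType) (x q : K) (n : int) : K :=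
  match n with
  | Posz m => \prod_(i < m) (1 - x * q ^+ i)
  | Negz m => (\prod_(i < m.+1) (1 - x * q ^- i.+1))^-1
  end.

Definition qpochs (K : numFieldType) (xs : seq K) (q : K) (n : int) : K :=
  \prod_(x <- xs) qpoch x q n.

Definition qpochs_inf (K : numFieldType) (xs : seq K) (q : K) : K :=
  \prod_(x <- xs) qpoch_inf x q.

(* No (x;q)_n with n < 0 has a vanishing denominator. *)
Definition qpoch_defined (K : numFieldType) (x q : K) : Prop :=
  forall k : nat, 1 - x * q ^- k.+1 != 0.

(* No (x;q)_n with n >= 0 vanishes. *)
Definition qpoch_nonzero (K : numFieldType) (x q : K) : Prop :=
  forall k : nat, 1 - x * q ^+ k != 0.

Definition bilateral_sum (K : numFieldType) (f : int -> K) (l : K) : Prop :=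
  exists l1 l2 : K,
    [/\ series (fun n : nat => f n%:Z) @ \oo --> l1,
        series (fun n : nat => f (- n.+1%:Z)) @ \oo --> l2
      & l = l1 + l2].

Section QuotientFormula.
Variables (K : numFieldType) (q : K).
Hypothesis q0 : q != 0.

Let P (x : K) (n : nat) := \prod_(i < n) (1 - x * q ^+ i).

Let PD x m k : P x (m + k) = P x m * P (x * q ^+ m) k.
Proof.
rewrite /P big_split_ord /=; congr (_ * _); apply: eq_bigr => i _.
by rewrite exprD mulrA.
Qed.

Let P_cvg x : qpoch_inf x q != 0 -> P x @ \oo --> qpoch_inf x q.
Proof.
move=> h; case: (pselect (cvg (P x @ \oo))) => // nc.
by move: h; rewrite /qpoch_inf dvgP // eqxx.
Qed.

Let P_shift x m :
  qpoch_inf (x * q ^+ m) q != 0 ->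
  qpoch_inf x q = P x m * qpoch_inf (x * q ^+ m) q.
Proof.
move=> /P_cvg h; apply: (@cvg_lim _ (@norm_hausdorff _ _)).
rewrite -(cvg_shiftn m).
under eq_fun do rewrite addnC -/(P _ _) PD.
exact: cvgMl_tmp.
Qed.

Lemma qpochE (x : K) (n : int) :
  qpoch_inf (x * q ^ n) q != 0 ->
  qpoch x q n = qpoch_inf x q / qpoch_inf (x * q ^ n) q.
Proof.
case: n => m.
  by rewrite -exprnP => h; rewrite (P_shift h) mulfK.
rewrite NegzE -exprnN => h; set y := x * q ^- m.+1 in h *.
have xE : y * q ^+ m.+1 = x by rewrite /y mulfVK // expf_neq0.
have PE : \prod_(i < m.+1) (1 - x * q ^- i.+1) = P y m.+1.
  rewrite /P (reindex_inj rev_ord_inj) /=; apply: eq_bigr => i _.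
  rewrite -xE subSS -mulrA; congr (1 - y * _).
  have lt_im : (i <= m)%N by rewrite -ltnS.
  by rewrite -{1}(subnKC lt_im) -addnS exprD mulfK // expf_neq0.
rewrite [LHS]/= PE; have Py := P_cvg h.
have Ps : (fun k => P y m.+1 * P x k) @ \oo --> qpoch_inf y q.
  move: Py; rewrite -(cvg_shiftn m.+1).
  by under eq_fun do rewrite addnC PD xE.
have P0 : P y m.+1 != 0.
  apply/negP => /eqP P0; move/eqP: h; apply.
  rewrite -(cvg_lim (@norm_hausdorff _ _) Ps).
  by under eq_fun do rewrite P0 mul0r; apply: lim_cst; exact: norm_hausdorff.
have -> : qpoch_inf x q = (P y m.+1)^-1 * qpoch_inf y q.
  apply: (@cvg_lim _ (@norm_hausdorff _ _)).
  rewrite (_ : (fun _ => _) = (fun k => (P y m.+1)^-1 * (P y m.+1 * P x k))).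
    exact: cvgMl_tmp.
  by apply/funext => k; rewrite mulKf.
by rewrite mulfK.
Qed.

End QuotientFormula.

(* Main.v *)
Require Import Defs.
From mathcomp Require Import all_boot all_order all_algebra.
From mathcomp Require Import complex.
From mathcomp Require Import all_classical all_reals all_analysis.
From mathcomp Require Import ring lra.

(* Write x = q^n and let W(n) be the well-poised term with parameters
   sqrt b, -sqrt b, s, t and argument w = -a^2/(bst).  The difference
   U(n+1) - U(n), with U(n) = W(n) (1 - a x/sqrt b) (1 + a x/sqrt b) (1 - a x/s)
   (1 - a x/t), is a linear combination of W(n) (1 - a^2 x^4) and
   W(n) x (1 - a x^2), so the mixed-base sum is a multiple of Bailey's 6psi6 sum.
   The latter satisfies, by a similar telescoping, a first-order recurrence in each
   parameter; iterating it sends the parameters to infinity one at a time, by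
   dominated convergence, and leaves a theta series in a.  That series is read off
   from the same formula at the parameters 1, a, oo, oo, where only the term n = 0
   survives, unless a is a power of q, where it vanishes by antisymmetry.
   Throughout, v stands for the inverse of a parameter, so that v = 0 is the
   parameter at infinity. *)

Set Implicit Arguments.
Unset Strict Implicit.
Unset Printing Implicit Defensive.

Import Order.TTheory GRing.Theory Num.Theory.
Import numFieldNormedType.Exports.

Local Open Scope classical_set_scope.
Local Open Scope ring_scope.
Local Open Scope complex_scope.

(* Naming the structure makes the topology of a numFieldType inferable on it. *)
Definition Cfield (R : realType) : numFieldType := R[i].

(** * Real-valued modulus, geometrically dominated series and dominated convergence *)

Section ComplexModulus.
Variable R : realType.
Local Notation K := (Cfield R).
Implicit Types (x y z l : K) (u : nat -> K).

(* The norm of R[i] takes its values in R[i]; this is its real version. *)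
Definition cabs z : R := complex.Re `|z|.

Lemma cabsE z : `|z| = (cabs z)%:C.
Proof. by rewrite /cabs normc_def. Qed.

Lemma cabs_ge0 z : 0 <= cabs z.
Proof. by rewrite -ler0c -cabsE. Qed.

Lemma cabsM x y : cabs (x * y) = cabs x * cabs y.
Proof. by apply: complexI; rewrite -cabsE normrM !cabsE rmorphM. Qed.

Lemma cabs0 : cabs 0 = 0.
Proof. by rewrite /cabs normr0. Qed.

Lemma cabs1 : cabs 1 = 1.
Proof. by rewrite /cabs normr1. Qed.

Lemma cabs_i : cabs 'i = 1.
Proof. by apply: complexI; rewrite -cabsE normc_def /= expr0n expr1n add0r sqrtr1. Qed.

Lemma cabsN z : cabs (- z) = cabs z.
Proof. by rewrite /cabs normrN. Qed.

Lemma cabsX z n : cabs (z ^+ n) = cabs z ^+ n.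
Proof. by elim: n => [|n IH]; rewrite ?cabs1 // !exprS cabsM IH. Qed.

Lemma cabsV z : cabs z^-1 = (cabs z)^-1.
Proof. by apply: complexI; rewrite -cabsE normfV cabsE fmorphV. Qed.

Lemma cabsD x y : cabs (x + y) <= cabs x + cabs y.
Proof. by rewrite -lecR -cabsE rmorphD /= -!cabsE ler_normD. Qed.

Lemma cabsB x y : cabs (x - y) <= cabs x + cabs y.
Proof. by rewrite -(cabsN y) cabsD. Qed.

Lemma cabs_subC x y : cabs (x - y) = cabs (y - x).
Proof. by rewrite -cabsN opprB. Qed.

Lemma cabs_lerB x y : cabs x - cabs y <= cabs (x - y).
Proof. by rewrite lerBlDr -{1}(subrK y x) cabsD. Qed.

Lemma cabs_sum (I : Type) (r : seq I) (P : pred I) (F : I -> K) :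
  cabs (\sum_(i <- r | P i) F i) <= \sum_(i <- r | P i) cabs (F i).
Proof.
elim/big_rec2: _ => [|i b c _ h]; first by rewrite cabs0.
by apply: (le_trans (cabsD _ _)); rewrite lerD2l.
Qed.

Lemma cabs_lt1 z : (cabs z < 1) = (`|z| < 1).
Proof. by rewrite cabsE -ltcR. Qed.

Lemma cvg_cabsP u l :
  u @ \oo --> l <-> forall e : R, 0 < e -> \forall n \near \oo, cabs (l - u n) < e.
Proof.
split=> [/cvgrPdist_lt h e e0|h].
  have /h : (0 : K) < e%:C by rewrite ltcR.
  by apply: filterS => n; rewrite cabsE ltcR.
apply/cvgrPdist_lt => e e0.
have eE : e = (complex.Re e)%:C by rewrite RRe_real // gtr0_real.
have /h : 0 < complex.Re e by rewrite -ltcR -eE.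
by apply: filterS => n ?; rewrite cabsE eE ltcR.
Qed.

Lemma cvgc_unique u l l' : u @ \oo --> l -> u @ \oo --> l' -> l = l'.
Proof.
move=> h h'; have E := cvg_lim (@norm_hausdorff _ K) h.
by rewrite -E; exact: (cvg_lim (@norm_hausdorff _ K) h').
Qed.

Lemma cvg_cabs u l : u @ \oo --> l -> cabs \o u @ \oo --> cabs l.
Proof.
move=> /cvg_cabsP h; apply/cvgrPdist_lt => e /h; apply: filterS => n /=.
apply: le_lt_trans; rewrite ler_norml; apply/andP; split.
  by rewrite lerNl opprB cabs_subC cabs_lerB.
exact: cabs_lerB.
Qed.

Lemma cvg_cabs_sub0 u l :
  u @ \oo --> l <-> (fun n => cabs (l - u n)) @ \oo --> (0 : R).
Proof.
rewrite cvg_cabsP; split=> [h|/cvgrPdist_lt h e /h].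
  apply/cvgrPdist_lt => e /h; apply: filterS => n.
  by rewrite sub0r normrN ger0_norm ?cabs_ge0.
by apply: filterS => n; rewrite sub0r normrN ger0_norm ?cabs_ge0.
Qed.

Lemma cvg_squeeze0 u (r : nat -> R) :
  (forall n, cabs (u n) <= r n) -> r @ \oo --> (0 : R) -> u @ \oo --> (0 : K).
Proof.
move=> ur r0; apply/cvg_cabs_sub0; apply: (squeeze_cvgr _ (cvg_cst 0) r0).
by apply: nearW => n; rewrite cabs_ge0 sub0r cabsN ur.
Qed.

Lemma cvg_bounded u l : u @ \oo --> l -> exists C, forall n, cabs (u n) <= C.
Proof.
move=> /cvg_cabs h.
have /cvg_seq_bounded/bounded_fun_has_ubound [C hC] : cvg (cabs \o u @ \oo).
  by apply/cvg_ex; exists (cabs l).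
by exists C => n; apply: hC; exists n.
Qed.

Lemma cvg_geom (C r : R) : 0 <= r < 1 -> (fun n => C * r ^+ n) @ \oo --> (0 : R).
Proof.
move=> /andP[r0 r1]; apply: (@cvg_geometric R C r).
by rewrite ger0_norm.
Qed.

Lemma cvg_expc x : cabs x < 1 -> (fun n => x ^+ n) @ \oo --> (0 : K).
Proof.
move=> x1; apply: (@cvg_squeeze0 _ (fun n => 1 * cabs x ^+ n)) => [n|].
  by rewrite mul1r cabsX.
by apply: cvg_geom; rewrite cabs_ge0.
Qed.

(** Real and imaginary parts are bounded by the modulus, so each converges by comparison with the
    geometric series; the two limits are then reassembled. *)
Lemma summable_geom u (C r : R) : 0 <= r < 1 ->
  (forall n, cabs (u n) <= C * r ^+ n) -> cvg (series u @ \oo).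
Proof.
move=> r01 h.
have real_part (f : K -> R) : (forall z, `|f z| <= cabs z) ->
    cvg (series (f \o u) @ \oo).
  move=> fz; apply: normed_cvg; apply: (series_le_cvg _ _ _
    (@is_cvg_geometric_series R C r _)) => [n|n|n|].
  - exact: normr_ge0.
  - by rewrite /= (le_trans (cabs_ge0 _) (h n)).
  - exact: le_trans (fz _) (h n).
  - by case/andP: r01 => ? ?; rewrite ger0_norm.
have cRe z : `|complex.Re z| <= cabs z by rewrite -lecR -cabsE normc_ge_Re.
(* Up to sign, the imaginary part of z is the real part of z times i, and i has modulus 1. *)
have cIm z : `|complex.Im z| <= cabs z.
  rewrite -normrN -ReiNIm (le_trans (cRe _)) // cabsM.
  by rewrite cabs_i mulr1.
have /cvg_ex[l1 h1] := real_part _ cRe.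
have /cvg_ex[l2 h2] := real_part _ cIm.
apply/cvg_ex; exists (l1 +i* l2); apply/cvg_cabsP => e e0.
have e20 : 0 < e / 2 by rewrite divr_gt0.
move/cvgrPdist_lt/(_ _ e20): h1 => h1; move/cvgrPdist_lt/(_ _ e20): h2 => h2.
near=> n.
have -> : (l1 +i* l2) - series u n =
    (l1 - series (@complex.Re R \o u) n)%:C
      + 'i * (l2 - series (@complex.Im R \o u) n)%:C.
  rewrite [RHS](_ : _ = (l1 - series (@complex.Re R \o u) n)
      +i* (l2 - series (@complex.Im R \o u) n)); last first.
    by apply/eqP; rewrite eq_complex /=; apply/andP; split; apply/eqP; ring.
  have sE : series u n = series (@complex.Re R \o u) n
      +i* series (@complex.Im R \o u) n.
    rewrite /series /=; elim/big_rec3: _ => //= i x y z _ ->.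
    by case: (u i).
  by rewrite sE.
have cR (r' : R) : cabs r'%:C = `|r'|.
  by rewrite /cabs normc_def /= expr0n addr0 sqrtr_sqr.
apply: (le_lt_trans (cabsD _ _)); rewrite cabsM cabs_i mul1r !cR.
by rewrite [e]splitr ltrD //; near: n.
Unshelve. all: by end_near. Qed.

(** A finite block of the geometric majorant, multiplied by 1 - r, telescopes; the bound on blocks
    from M to n then passes to the limit in n. *)
Lemma series_tail_geom u (C r : R) M : 0 <= r < 1 ->
  (forall n, cabs (u n) <= C * r ^+ n) ->
  cabs (lim (series u @ \oo) - series u M) <= C * r ^+ M / (1 - r).
Proof.
move=> r01 h; have cu := summable_geom r01 h.
have /andP[r0 r1] := r01; have r1' : 0 < 1 - r by rewrite subr_gt0.
have C0 : 0 <= C.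
  by have := le_trans (cabs_ge0 _) (h 0%N); rewrite expr0 mulr1.
have : (fun n => series u n - series u M) @ \oo -->
    lim (series u @ \oo) - series u M.
  apply: cvgB; first exact: cu.
  exact: cvg_cst.
move/cvg_cabs => hc; apply: (cvgr_to_le hc); near=> n => /=.
have Mn : (M <= n)%N by near: n; exact: nbhs_infty_ge.
rewrite sub_series_geq //.
apply: (le_trans (cabs_sum _ _ _)).
apply: (@le_trans _ _ (\sum_(M <= i < n) C * r ^+ i)).
  by apply: ler_sum => i _; exact: h.
rewrite ler_pdivlMr // mulr_suml.
have -> : \sum_(M <= i < n) C * r ^+ i * (1 - r) = C * r ^+ M - C * r ^+ n.
  have /= E := telescope_sumr (fun i => C * r ^+ i) Mn.
  rewrite -[RHS]opprB -E -sumrN.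
  by apply: eq_bigr => i _; rewrite exprS; ring.
by rewrite lerBlDr lerDl mulr_ge0 // exprn_ge0.
Unshelve. all: by end_near. Qed.

(** Dominated convergence by three thirds of epsilon: beyond some M the tails of g and of every
    [f N] are small at once, and the first M terms form a finite sum that converges. *)
Lemma tannery (f : nat -> nat -> K) (g : nat -> K) (C r : R) : 0 <= r < 1 ->
  (forall n, f^~ n @ \oo --> g n) ->
  (forall N n, cabs (f N n) <= C * r ^+ n) ->
  (fun N => lim (series (f N) @ \oo)) @ \oo --> lim (series g @ \oo).
Proof.
move=> r01 fg h; have /andP[r0 r1] := r01.
have r1' : 0 < 1 - r by rewrite subr_gt0.
have hg n : cabs (g n) <= C * r ^+ n.
  by apply: (cvgr_to_le (cvg_cabs (fg n))); apply: nearW => N; exact: h.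
apply/cvg_cabsP => e e0; have e30 : 0 < e / 3 by rewrite divr_gt0.
have [M hM] : exists M, C * r ^+ M / (1 - r) < e / 3.
  have : (fun M => (C / (1 - r)) * r ^+ M) @ \oo --> (0 : R) by exact: cvg_geom.
  move=> /cvgrPdist_lt /(_ _ e30) [M _ /(_ M (leqnn M))] /=.
  rewrite sub0r normrN => hM; exists M.
  by rewrite mulrAC; exact: le_lt_trans (ler_norm _) hM.
have sM : (fun N => series (f N) M) @ \oo --> series g M.
  by apply: cvg_big => // -[x y]; exact: add_continuous.
have := sM => /cvg_cabsP /(_ _ e30) sM'.
near=> N.
have -> : lim (series g @ \oo) - lim (series (f N) @ \oo) =
  (lim (series g @ \oo) - series g M) + (series g M - series (f N) M)
    - (lim (series (f N) @ \oo) - series (f N) M) by ring.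
have -> : e = e / 3 + e / 3 + e / 3 by field.
apply: (le_lt_trans (cabsB _ _)); apply: ltrD; last first.
  exact: le_lt_trans (series_tail_geom M r01 (h N)) hM.
apply: (le_lt_trans (cabsD _ _)); apply: ltrD; last by near: N.
exact: le_lt_trans (series_tail_geom M r01 hg) hM.
Unshelve. all: by end_near. Qed.

End ComplexModulus.

(** * A uniform ratio test and the convergence of infinite products *)

Section RatioTest.
Variable R : realType.
Local Notation K := (Cfield R).

(** The threshold [n0] is common to all N, so C only has to absorb the finitely many columns n <=
    n0, each bounded uniformly in N; beyond [n0] the ratio propagates the bound. *)
Lemma ratio_geom (f : nat -> nat -> K) (r : R) (n0 : nat) : 0 < r ->
  (forall n, exists B, forall N, cabs (f N n) <= B) ->
  (forall N n, (n0 <= n)%N -> cabs (f N n.+1) <= r * cabs (f N n)) ->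
  exists C, forall N n, cabs (f N n) <= C * r ^+ n.
Proof.
move=> r0 bd ratio.
have [C hC] : exists C, forall N n, (n <= n0)%N -> cabs (f N n) <= C * r ^+ n.
  elim: n0 {ratio} => [|m [C hC]].
    have [B hB] := bd 0%N; exists B => N n; rewrite leqn0 => /eqP ->.
    by rewrite expr0 mulr1.
  have [B hB] := bd m.+1; exists (Num.max C (B / r ^+ m.+1)) => N n.
  have rn k : 0 < r ^+ k by rewrite exprn_gt0.
  rewrite leq_eqVlt => /orP[/eqP ->|].
    by rewrite -ler_pdivrMr // le_max ler_pM2r ?invr_gt0 // hB orbT.
  rewrite ltnS => nm; apply: (le_trans (hC N n nm)).
  by rewrite ler_pM2r // le_max lexx.
exists C => N n; have [/hC //|n0n] := leqP n n0.
rewrite -(subnKC (ltnW n0n)); elim: (n - n0)%N => [|k IH].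
  by rewrite addn0; apply: hC.
rewrite addnS; apply: le_trans (ratio _ _ (leq_addr _ _)) _.
by rewrite exprS mulrCA ler_pM2l.
Qed.

(** From 1 + x <= exp x the partial products are bounded by the exponential of a geometric sum.
    Since P(n+1) - P(n) = P(n) u(n), they are the partial sums of a geometrically dominated
    series. *)
Lemma cvg_prod_geom (u : nat -> K) (c r : R) : 0 <= r < 1 ->
  (forall n, cabs (u n) <= c * r ^+ n) ->
  cvg ((fun n => \prod_(i < n) (1 + u i)) @ \oo).
Proof.
move=> r01 h; have /andP[r0 r1] := r01.
have c0 : 0 <= c by have := le_trans (cabs_ge0 _) (h 0%N); rewrite expr0 mulr1.
have r1' : 0 < 1 - r by rewrite subr_gt0.
set P := fun n => \prod_(i < n) (1 + u i).
have bound n : cabs (P n) <= expR (c * (1 - r ^+ n) / (1 - r)).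
  elim: n => [|n IH].
    by rewrite /P big_ord0 cabs1 expr0 subrr mulr0 mul0r expR0.
  rewrite /P big_ord_recr /= cabsM -/(P n).
  have -> : c * (1 - r ^+ n.+1) / (1 - r) =
      c * (1 - r ^+ n) / (1 - r) + c * r ^+ n.
    by rewrite exprS; field; rewrite gt_eqF.
  rewrite expRD; apply: ler_pM => //; rewrite ?cabs_ge0 //.
  apply: le_trans (cabsD _ _) _; rewrite cabs1.
  exact: le_trans (lerD (lexx 1) (h n)) (expR_ge1Dx _).
pose B := expR (c / (1 - r)).
have bB n : cabs (P n) <= B.
  apply: (le_trans (bound n)); rewrite ler_expR ler_pM2r ?invr_gt0 //.
  by rewrite -{2}(mulr1 c) ler_wpM2l // gerBl exprn_ge0.
have PE : P = (fun n => 1 + series (fun i => P i * u i) n).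
  apply/funext; elim=> [|n IH]; first by rewrite /P /series /= big_ord0 big_geq // addr0.
  rewrite /series /= big_nat_recr //= addrA -[X in X + _]IH.
  by rewrite /P big_ord_recr /= -/(P n) mulrDr mulr1.
have cs : cvg (series (fun i => P i * u i) @ \oo).
  apply: (@summable_geom R _ (B * c) r) => // n.
  by rewrite cabsM -mulrA ler_pM ?cabs_ge0.
apply/cvg_ex; exists (1 + lim (series (fun i => P i * u i) @ \oo)).
by rewrite [X in X @ _]PE; apply: cvgD; [exact: cvg_cst | exact: cs].
Qed.

End RatioTest.

(** * The infinite product (x;q)_oo *)

Section InfiniteProducts.
Variable R : realType.
Local Notation K := (Cfield R).
Variable q : K.
Hypothesis q_lt1 : cabs q < 1.

Let q01 : 0 <= cabs q < 1. Proof. by rewrite cabs_ge0. Qed.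

Lemma cvg_qpoch_inf (x : K) :
  (fun n : nat => \prod_(i < n) (1 - x * q ^+ i)) @ \oo --> qpoch_inf x q.
Proof.
apply: (@cvg_prod_geom R (fun i => - (x * q ^+ i)) (cabs x) (cabs q)) => // n.
by rewrite cabsN cabsM cabsX.
Qed.

Lemma qpoch_inf_eq (x l : K) :
  (fun n : nat => \prod_(i < n) (1 - x * q ^+ i)) @ \oo --> l -> qpoch_inf x q = l.
Proof. by move=> h; apply: (@cvg_lim _ (@norm_hausdorff _ _)); exact: h. Qed.

Lemma qpoch_infS (x : K) : qpoch_inf x q = (1 - x) * qpoch_inf (x * q) q.
Proof.
apply: qpoch_inf_eq; rewrite -(cvg_shiftn 1).
under eq_fun => n do rewrite addn1 big_ord_recl expr0 mulr1.
apply: cvgMl_tmp.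
under eq_fun => n do (under eq_bigr => i _ do rewrite /= /bump /= add1n exprS mulrA).
exact: cvg_qpoch_inf.
Qed.

Lemma qpoch_inf_shift (x : K) n :
  qpoch_inf x q = (\prod_(i < n) (1 - x * q ^+ i)) * qpoch_inf (x * q ^+ n) q.
Proof.
elim: n => [|n IH]; first by rewrite big_ord0 mul1r expr0 mulr1.
rewrite IH big_ord_recr /= -mulrA; congr (_ * _).
by rewrite qpoch_infS exprSr mulrA.
Qed.

Lemma qpoch_inf_root (x : K) n : x * q ^+ n = 1 -> qpoch_inf x q = 0.
Proof.
by move=> h; rewrite (qpoch_inf_shift x n) qpoch_infS h subrr mul0r mulr0.
Qed.

(** The product of the inverse factors converges as well, and the two partial products multiply to
    1, so the limit cannot be 0. *)
Lemma qpoch_inf_neq0 (x : K) :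
  (forall n, 1 - x * q ^+ n != 0) -> qpoch_inf x q != 0.
Proof.
move=> nz.
have xq0 : (fun n => 1 - x * q ^+ n) @ \oo --> (1 : K).
  rewrite -[X in _ --> X]subr0; apply: cvgB; first exact: cvg_cst.
  by rewrite -[X in _ --> X](mulr0 x); apply: cvgMl_tmp; exact: cvg_expc.
(* The inverse factors tend to 1, hence are bounded; writing 1/(1 - y) = 1 + y/(1 - y) then gives a
   geometric bound on the deviation from 1. *)
have [B hB] := cvg_bounded (cvgV (oner_neq0 K) xq0).
have /cvg_ex[l hl] : cvg ((fun n => \prod_(i < n) (1 - x * q ^+ i)^-1) @ \oo).
  have -> : (fun n => \prod_(i < n) (1 - x * q ^+ i)^-1) =
      (fun n => \prod_(i < n) (1 + x * q ^+ i / (1 - x * q ^+ i))).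
    apply/funext => n; apply: eq_bigr => i _.
    by have := nz i; set y := x * _ => ny; field.
  apply: (@cvg_prod_geom R (fun i => x * q ^+ i / (1 - x * q ^+ i)) (cabs x * B)
    (cabs q)) => // n.
  rewrite !cabsM mulrAC cabsX ler_wpM2r ?exprn_ge0 ?cabs_ge0 //.
  by rewrite ler_wpM2l ?cabs_ge0 //; exact: hB.
apply/negP => /eqP z0.
have h0 : (fun n => (\prod_(i < n) (1 - x * q ^+ i))
    * \prod_(i < n) (1 - x * q ^+ i)^-1) @ \oo --> qpoch_inf x q * l.
  by apply: cvgM; [exact: cvg_qpoch_inf | exact: hl].
move: h0; rewrite z0 mul0r (_ : (fun n => _) = fun=> 1) => [h1|]; last first.
  apply/funext => n /=; rewrite -big_split /= big1 // => i _.
  by rewrite divff.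
have /eqP : (0 : K) = 1 by apply: (cvgc_unique h1); exact: cvg_cst.
by rewrite eq_sym oner_eq0.
Qed.

End InfiniteProducts.

(** * Bilateral sums: linearity, telescoping, shift, reflection, dominated convergence *)

Lemma oppzSD1 (i : nat) : - i.+1%:Z + 1 = - i%:Z.
Proof. by rewrite intS opprD addrAC addNr add0r. Qed.

Section BilateralSums.
Variable R : realType.
Local Notation K := (Cfield R).
Implicit Types (f g : int -> K) (l m : K).

(** A total function, so that a sum can be named before its convergence is known; by [bsumE] it
    agrees with any sum that exists. *)
Definition bsum f : K :=
  lim (series (fun n : nat => f n%:Z) @ \oo)
  + lim (series (fun n : nat => f (- n.+1%:Z)) @ \oo).

Lemma bsumE f l : bilateral_sum f l -> bsum f = l.
Proof.
move=> [l1 [l2 [h1 h2 ->]]]; congr (_ + _).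
  by apply: (@cvg_lim _ (@norm_hausdorff _ _)); exact: h1.
by apply: (@cvg_lim _ (@norm_hausdorff _ _)); exact: h2.
Qed.

Lemma bilateral_sum_unique f l m :
  bilateral_sum f l -> bilateral_sum f m -> l = m.
Proof. by move=> /bsumE <- /bsumE <-. Qed.

Lemma bilateral_sum_geom f (C r : R) : 0 <= r < 1 ->
  (forall n : nat, cabs (f n%:Z) <= C * r ^+ n) ->
  (forall n : nat, cabs (f (- n%:Z)) <= C * r ^+ n) ->
  bilateral_sum f (bsum f).
Proof.
move=> r01 h1 h2.
exists (lim (series (fun n : nat => f n%:Z) @ \oo)).
exists (lim (series (fun n : nat => f (- n.+1%:Z)) @ \oo)); split => //.
  exact: (summable_geom r01 h1).
(* The backward half starts at -1, so its n-th term is bounded by C r^(n+1). *)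
apply: (@summable_geom R _ (C * r) r r01) => n.
by rewrite -mulrA -exprS; exact: h2.
Qed.

Lemma bilateral_sum_lin f g l m (x y : K) :
  bilateral_sum f l -> bilateral_sum g m ->
  bilateral_sum (fun n => x * f n + y * g n) (x * l + y * m).
Proof.
move=> [l1 [l2 [h1 h2 ->]]] [m1 [m2 [k1 k2 ->]]].
exists (x * l1 + y * m1), (x * l2 + y * m2); split; last by ring.
- rewrite (_ : series _ = (fun n => x * series (fun n : nat => f n%:Z) n
    + y * series (fun n : nat => g n%:Z) n)).
    by apply: cvgD; apply: cvgMl_tmp; [exact: h1 | exact: k1].
  by apply/funext => n; rewrite /series /= big_split /= -!mulr_sumr.
- rewrite (_ : series _ = (fun n => x * series (fun n : nat => f (- n.+1%:Z)) n
    + y * series (fun n : nat => g (- n.+1%:Z)) n)).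
    by apply: cvgD; apply: cvgMl_tmp; [exact: h2 | exact: k2].
  by apply/funext => n; rewrite /series /= big_split /= -!mulr_sumr.
Qed.

Lemma bilateral_sumZ f l (x : K) :
  bilateral_sum f l -> bilateral_sum (fun n => x * f n) (x * l).
Proof.
move=> h; have := bilateral_sum_lin x 0 h h.
rewrite mul0r addr0; congr (bilateral_sum _ _).
by apply/funext => n; rewrite mul0r addr0.
Qed.

Lemma bilateral_sum_telescope (U : int -> K) :
  (fun n : nat => U n%:Z) @ \oo --> (0 : K) ->
  (fun n : nat => U (- n%:Z)) @ \oo --> (0 : K) ->
  bilateral_sum (fun n => U (n + 1) - U n) 0.
Proof.
(* Each half telescopes to its boundary value at 0, and the two values cancel. *)
move=> h1 h2; exists (- U 0), (U 0); split; last by rewrite addNr.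
- rewrite (_ : series _ = (fun n : nat => U n%:Z - U 0)).
    rewrite -[X in _ --> X]sub0r; apply: cvgB; [exact: h1 | exact: cvg_cst].
  apply/funext => n; rewrite /series /=.
  rewrite -(telescope_sumr (fun i : nat => U i%:Z) (leq0n n)).
  by apply: eq_bigr => i _; rewrite intS [1 + _]addrC.
- rewrite (_ : series _ = (fun n : nat => U 0 - U (- n%:Z))).
    rewrite -[X in _ --> X]subr0; apply: cvgB; [exact: cvg_cst | exact: h2].
  apply/funext => n; rewrite /series /=.
  have /= E := telescope_sumr (fun i : nat => U (- i%:Z)) (leq0n n).
  rewrite oppr0 in E; rewrite -opprB -E -sumrN.
  by apply: eq_bigr => i _; rewrite opprB oppzSD1.
Qed.

Lemma bilateral_sum_shift f l :
  bilateral_sum f l -> bilateral_sum (fun n => f (n + 1)) l.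
Proof.
(* After the shift the term [f 0] sits at index -1, so it moves from the forward half to the
   backward one. *)
move=> [l1 [l2 [h1 h2 ->]]]; exists (l1 - f 0), (l2 + f 0); split; last by ring.
- rewrite (_ : series _ = (fun n => series (fun n : nat => f n%:Z) (n + 1)%N - f 0)).
    apply: cvgB; last exact: cvg_cst.
    by have := h1; rewrite -(cvg_shiftn 1).
  apply/funext => n; rewrite /series /= addn1 big_nat_recl // addrC addKr.
  by apply: eq_bigr => i _; rewrite intS [1 + _]addrC.
- rewrite -(cvg_shiftn 1) (_ : (fun n => _) =
      (fun n => series (fun n : nat => f (- n.+1%:Z)) n + f 0)).
    by apply: cvgD; [exact: h2 | exact: cvg_cst].
  apply/funext => n; rewrite /series /= addn1 big_nat_recl // addNr addrC.
  congr (_ + _); apply: eq_bigr => i _; congr f.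
  by rewrite oppzSD1.
Qed.

Lemma bilateral_sum_opp f l :
  bilateral_sum f l -> bilateral_sum (fun n => f (- n)) l.
Proof.
move=> [l1 [l2 [h1 h2 ->]]]; exists (l2 + f 0), (l1 - f 0); split; last by ring.
- rewrite -(cvg_shiftn 1) (_ : (fun n => _) =
      (fun n => series (fun n : nat => f (- n.+1%:Z)) n + f 0)).
    by apply: cvgD; [exact: h2 | exact: cvg_cst].
  by apply/funext => n; rewrite /series /= addn1 big_nat_recl // oppr0 addrC.
- rewrite (_ : series _ = (fun n => series (fun n : nat => f n%:Z) (n + 1)%N - f 0)).
    apply: cvgB; last exact: cvg_cst.
    by have := h1; rewrite -(cvg_shiftn 1).
  apply/funext => n; rewrite /series /= addn1 big_nat_recl // addrC addKr.
  by apply: eq_bigr => i _; rewrite opprK.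
Qed.

Lemma bilateral_sum_shiftz f l (k : int) :
  bilateral_sum f l -> bilateral_sum (fun n => f (n + k)) l.
Proof.
have shiftn (m : nat) g : bilateral_sum g l -> bilateral_sum (fun n => g (n + m%:Z)) l.
  elim: m g => [|m IH] g h.
    by rewrite (_ : (fun n => _) = g) //; apply/funext => n; rewrite addr0.
  have := bilateral_sum_shift (IH _ h); congr (bilateral_sum _ _).
  by apply/funext => n; rewrite intS addrA.
case: k => m h; first exact: shiftn.
(* A negative shift is a positive one conjugated by n -> -n. *)
have := bilateral_sum_opp (shiftn m.+1 _ (bilateral_sum_opp h)).
congr (bilateral_sum _ _).
by apply/funext => n; rewrite opprD opprK NegzE.
Qed.

Lemma bsum_tannery (f : nat -> int -> K) g (C r : R) : 0 <= r < 1 ->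
  (forall n, f^~ n @ \oo --> g n) ->
  (forall N (n : nat), cabs (f N n%:Z) <= C * r ^+ n) ->
  (forall N (n : nat), cabs (f N (- n%:Z)) <= C * r ^+ n) ->
  (fun N => bsum (f N)) @ \oo --> bsum g.
Proof.
move=> r01 fg h1 h2; apply: cvgD.
  apply: (@tannery R (fun N n => f N n%:Z) (fun n => g n%:Z) C r r01)
    => [n|N n]; [exact: fg | exact: h1].
apply: (@tannery R (fun N n => f N (- n.+1%:Z)) (fun n => g (- n.+1%:Z))
  (C * r) r r01) => [n|N n]; first exact: fg.
by rewrite -mulrA -exprS; exact: h2.
Qed.

End BilateralSums.

(** * Well-poised terms: recurrences, reflection and geometric bounds *)

Section WellPoised.
Variable R : realType.
Local Notation K := (Cfield R).
Variable q : K.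
Hypotheses (q_neq0 : q != 0) (q_lt1 : cabs q < 1).
Implicit Types (a v x : K) (m N : nat) (n : int).

Definition wpn a v m : K := \prod_(i < m) ((v - q ^+ i) / (1 - a * v * q ^+ i.+1)).

(* (1/v; q)_n / (a v q; q)_n * v^n, in a form that makes sense for v = 0. *)
Definition wp a v n : K :=
  match n with
  | Posz m => wpn a v m
  | Negz m => q ^+ m.+1 * wpn a^-1 (a * v) m.+1
  end.

(** The first inequality keeps the denominators at n < 0 nonzero, the second those at n > 0. *)
Definition wp_regular a v : Prop :=
  forall k : nat, (1 - v * q ^+ k.+1 != 0) /\ (1 - a * v * q ^+ k.+1 != 0).

(** The reflection n -> -n replaces (a, v) by (1/a, a v), which exchanges the two inequalities. This
    duality reduces negative indices to nonnegative ones. *)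
Lemma wp_regular_dual a v : a != 0 -> wp_regular a v -> wp_regular a^-1 (a * v).
Proof. by move=> a0 h k; have [? ?] := h k; rewrite mulKf. Qed.

Lemma wp_regularM a v N : wp_regular a v -> wp_regular a (v * q ^+ N).
Proof.
by move=> h k; have [? ?] := h (N + k)%N; rewrite mulrA -!(mulrA _ (q ^+ N)) -exprD addnS.
Qed.

Lemma wp_regular0 a : wp_regular a 0.
Proof. by move=> k; rewrite mulr0 mul0r subr0 oner_neq0. Qed.

Lemma wpnS a v m :
  wpn a v m.+1 = wpn a v m * ((v - q ^+ m) / (1 - a * v * q ^+ m.+1)).
Proof. by rewrite /wpn big_ord_recr. Qed.

Lemma wp_neg a v m : wp a v (- m%:Z) = q ^+ m * wpn a^-1 (a * v) m.
Proof. by case: m => [|m] //; rewrite /wp /wpn /= !big_ord0 mulr1. Qed.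

Lemma wp_step a v n : a != 0 -> wp_regular a v ->
  wp a v (n + 1) * (1 - a * v * q * q ^ n) = wp a v n * (v - q ^ n).
Proof.
move=> a0 h; case: n => m.
  rewrite -PoszD addn1 /wp wpnS -exprnP -[a * v * q * _]mulrA -exprS.
  by have [_ h1] := h m; rewrite -mulrA divfK.
rewrite NegzE oppzSD1 !wp_neg wpnS mulKf // -exprnN.
have [h1 _] := h m; rewrite exprS in h1 *.
have Q0 : q ^+ m != 0 by rewrite expf_neq0.
by set Q := q ^+ m in h1 Q0 *; field; rewrite h1 Q0 q_neq0.
Qed.

(** Replacing v by v q moves every factor one place along, so only end factors remain in the
    quotient. The relation is cross-multiplied because q^m - v q vanishes when v = q^(m-1). *)
Lemma wpn_shift a v m : wp_regular a v ->
  wpn a v m * ((1 - v * q) * (1 - a * v * q)) * q ^+ m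
    = wpn a (v * q) m * ((q ^+ m - v * q) * (1 - a * v * q * q ^+ m)).
Proof.
move=> h; elim: m => [|m IH]; first by rewrite /wpn !big_ord0 expr0; ring.
rewrite !wpnS; have [_ h1] := h m; have [_ h2] := h m.+1.
rewrite !exprS in h1 h2 *; set Q := q ^+ m in IH h1 h2 *.
have -> : wpn a v m * ((v - Q) / (1 - a * v * (q * Q))) *
    ((1 - v * q) * (1 - a * v * q)) * (q * Q) =
    (wpn a v m * ((1 - v * q) * (1 - a * v * q)) * Q) *
      ((v - Q) / (1 - a * v * (q * Q)) * q) by ring.
rewrite IH; field; rewrite h1 /=.
by rewrite andbT; apply: contra h2 => /eqP E; apply/eqP; rewrite -E; ring.
Qed.

Lemma wp_shift a v n : a != 0 -> wp_regular a v ->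
  wp a v n * ((1 - v * q) * (1 - a * v * q)) * q ^ n
    = wp a (v * q) n * ((q ^ n - v * q) * (1 - a * v * q * q ^ n)).
Proof.
move=> a0 h; case: n => m; first exact: wpn_shift.
rewrite NegzE !wp_neg -exprnN.
have := @wpn_shift a^-1 (a * v) m.+1 (wp_regular_dual a0 h).
rewrite mulKf // [a * (v * q)]mulrA.
have Q0 : q ^+ m.+1 != 0 by rewrite expf_neq0.
set Q := q ^+ m.+1 in Q0 *; set W := wpn _ _ _; set W' := wpn _ _ _ => E.
have -> : Q * W * ((1 - v * q) * (1 - a * v * q)) / Q =
    (W * ((1 - a * v * q) * (1 - v * q)) * Q) / Q by ring.
by rewrite E; field.
Qed.

(** The well-poised term with parameters 1/v1, ..., 1/v4 and argument a^2 v1 v2 v3 v4, without the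
    very-well-poised factor. *)
Definition wp4 a v1 v2 v3 v4 n : K :=
  (a ^+ 2) ^ n * (wp a v1 n * wp a v2 n * wp a v3 n * wp a v4 n).

Lemma wp4_step a v1 v2 v3 v4 n : a != 0 -> wp_regular a v1 -> wp_regular a v2 ->
  wp_regular a v3 -> wp_regular a v4 ->
  wp4 a v1 v2 v3 v4 (n + 1)
    * ((1 - a * v1 * q * q ^ n) * (1 - a * v2 * q * q ^ n)
       * (1 - a * v3 * q * q ^ n) * (1 - a * v4 * q * q ^ n))
  = wp4 a v1 v2 v3 v4 n
    * (a ^+ 2 * ((v1 - q ^ n) * (v2 - q ^ n) * (v3 - q ^ n) * (v4 - q ^ n))).
Proof.
move=> a0 /(wp_step n a0) h1 /(wp_step n a0) h2 /(wp_step n a0) h3 /(wp_step n a0) h4.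
rewrite /wp4 expfzDr ?expf_neq0 // expr1z.
have cross (p w1 w2 w3 w4 d1 d2 d3 d4 : K) :
  p * (w1 * w2 * w3 * w4) * (d1 * d2 * d3 * d4) =
  p * ((w1 * d1) * (w2 * d2) * (w3 * d3) * (w4 * d4)) by ring.
have cross' (p c w1 w2 w3 w4 d1 d2 d3 d4 : K) :
  p * c * ((w1 * d1) * (w2 * d2) * (w3 * d3) * (w4 * d4)) =
  p * (w1 * w2 * w3 * w4) * (c * (d1 * d2 * d3 * d4)) by ring.
by rewrite cross h1 h2 h3 h4 cross'.
Qed.

Lemma wp4_neg a v1 v2 v3 v4 m : wp4 a v1 v2 v3 v4 (- m%:Z) =
  (q ^+ m) ^+ 4 * wp4 a^-1 (a * v1) (a * v2) (a * v3) (a * v4) m%:Z.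
Proof.
rewrite /wp4 !wp_neg /= -exprnN -exprnP exprVn exprVn.
ring.
Qed.

Lemma wp4_shift a v1 v2 v3 v4 n : a != 0 -> wp_regular a v4 ->
  wp4 a v1 v2 v3 v4 n * ((1 - v4 * q) * (1 - a * v4 * q)) * q ^ n =
  wp4 a v1 v2 v3 (v4 * q) n * ((q ^ n - v4 * q) * (1 - a * v4 * q * q ^ n)).
Proof.
move=> a0 /(wp_shift n a0) h; rewrite /wp4.
have cross (p w1 w2 w3 w4 d x : K) :
  p * (w1 * w2 * w3 * w4) * d * x = p * (w1 * w2 * w3) * (w4 * d * x) by ring.
by rewrite cross h !mulrA.
Qed.

(** Degree 4 is the largest that the factor q^(4m) of [wp4_neg] can absorb at x = q^(-m), so these
    are the weights under which both halves stay geometric. *)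
Definition quartic (p : K -> K) : Prop := exists c0 c1 c2 c3 c4 : K,
  forall x, p x = c0 + c1 * x + c2 * x ^+ 2 + c3 * x ^+ 3 + c4 * x ^+ 4.

Lemma quartic_bound p : quartic p -> exists B : R, 0 <= B /\
  forall m, cabs (p (q ^ m%:Z)) <= B /\ cabs ((q ^+ m) ^+ 4 * p (q ^ (- m%:Z))) <= B.
Proof.
move=> [c0 [c1 [c2 [c3 [c4 pE]]]]].
exists (cabs c0 + cabs c1 + cabs c2 + cabs c3 + cabs c4); split.
  by rewrite !addr_ge0 ?cabs_ge0.
move=> m; have Q0 : q ^+ m != 0 by rewrite expf_neq0.
have Q1 : cabs (q ^+ m) <= 1 by rewrite cabsX exprn_ile1 ?cabs_ge0 // ltW.
rewrite !pE -exprnN -exprnP; set Q := q ^+ m in Q0 Q1 *.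
have le (c : K) k : cabs (c * Q ^+ k) <= cabs c.
  by rewrite cabsM cabsX ler_piMr ?cabs_ge0 // exprn_ile1 ?cabs_ge0.
have sum5 (y0 y1 y2 y3 y4 : K) :
  cabs (y0 + y1 + y2 + y3 + y4) <= cabs y0 + cabs y1 + cabs y2 + cabs y3 + cabs y4.
  by do 4![apply: le_trans (cabsD _ _) _; rewrite lerD2r].
split.
  by apply: le_trans (sum5 _ _ _ _ _) _; rewrite !lerD // -[X in c1 * X]expr1.
have -> : Q ^+ 4 * (c0 + c1 / Q + c2 * Q^-1 ^+ 2 + c3 * Q^-1 ^+ 3 + c4 * Q^-1 ^+ 4) =
   c0 * Q ^+ 4 + c1 * Q ^+ 3 + c2 * Q ^+ 2 + c3 * Q ^+ 1 + c4 by field.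
by apply: le_trans (sum5 _ _ _ _ _) _; rewrite !lerD.
Qed.

Lemma cvg_mul_expr_shift (c : K) (k : nat) : (fun m => c * q ^+ (m + k)) @ \oo --> (0 : K).
Proof.
rewrite -[X in _ --> X](mulr0 c); apply: cvgMl_tmp.
by rewrite (cvg_shiftn k (GRing.exp q)); exact: cvg_expc.
Qed.

Lemma cvg_wp_factor a v :
  (fun n : nat => (v - q ^+ n) / (1 - a * v * q ^+ n.+1)) @ \oo --> v.
Proof.
rewrite -[X in _ --> X]divr1; apply: cvgM.
  rewrite -[X in _ --> X]subr0; apply: cvgB; first exact: cvg_cst.
  exact: cvg_expc.
apply: cvgV; first exact: oner_neq0.
rewrite -[X in _ --> X]subr0; apply: cvgB; first exact: cvg_cst.
by have := @cvg_mul_expr_shift (a * v) 1; under eq_fun do rewrite addn1.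
Qed.

Lemma wp4S a v1 v2 v3 v4 m : wp4 a v1 v2 v3 v4 m.+1%:Z =
  wp4 a v1 v2 v3 v4 m%:Z * (a ^+ 2
    * ((v1 - q ^+ m) / (1 - a * v1 * q ^+ m.+1))
    * ((v2 - q ^+ m) / (1 - a * v2 * q ^+ m.+1))
    * ((v3 - q ^+ m) / (1 - a * v3 * q ^+ m.+1))
    * ((v4 - q ^+ m) / (1 - a * v4 * q ^+ m.+1))).
Proof. by rewrite /wp4 /= !wpnS -!exprnP exprS; ring. Qed.

(** The ratio of consecutive terms tends to a^2 v1 v2 v3 v4, and [r] is taken halfway between the
    modulus of this limit and 1. *)
Lemma wp4_geom a v1 v2 v3 v4 : cabs (a ^+ 2 * v1 * v2 * v3 * v4) < 1 ->
  exists (C r : R), 0 <= r < 1 /\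
    forall m, cabs (wp4 a v1 v2 v3 v4 m%:Z) <= C * r ^+ m.
Proof.
move=> h; set w := a ^+ 2 * _ * _ * _ * _ in h.
pose r := (1 + cabs w) / 2.
have w0 := cabs_ge0 w.
have r0 : 0 < r by rewrite /r; lra.
have wr : cabs w < r by rewrite /r; lra.
have r1 : r < 1 by rewrite /r; lra.
pose rho (m : nat) := a ^+ 2
    * ((v1 - q ^+ m) / (1 - a * v1 * q ^+ m.+1))
    * ((v2 - q ^+ m) / (1 - a * v2 * q ^+ m.+1))
    * ((v3 - q ^+ m) / (1 - a * v3 * q ^+ m.+1))
    * ((v4 - q ^+ m) / (1 - a * v4 * q ^+ m.+1)).
have rhow : rho @ \oo --> w.
  by do 3![apply: cvgM; last exact: cvg_wp_factor]; apply: cvgMl_tmp;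
    exact: cvg_wp_factor.
have [n0 _ hn0] : \forall n \near \oo, cabs (rho n) <= r.
  exact: (@cvgr_le _ _ _ _ (@cabs R \o rho) (cabs w) (cvg_cabs rhow) r wr).
have [||C hC] := @ratio_geom R (fun _ m => wp4 a v1 v2 v3 v4 m%:Z) r n0 r0.
- by move=> n; exists (cabs (wp4 a v1 v2 v3 v4 n%:Z)).
- move=> _ n n0n; rewrite wp4S cabsM mulrC ler_wpM2r ?cabs_ge0 //.
  exact: (hn0 n n0n).
by exists C, r; split=> [|m]; [rewrite ltW | exact: (hC 0%N)].
Qed.

Lemma cvg_wp_param a v n : (fun N => wp a (v * q ^+ N) n) @ \oo --> wp a 0 n.
Proof.
have vq0 w : (fun N => w * q ^+ N) @ \oo --> (0 : K).
  by rewrite -[X in _ --> X](mulr0 w); apply: cvgMl_tmp; exact: cvg_expc.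
have nat_case b w m : (fun N => wpn b (w * q ^+ N) m) @ \oo --> wpn b 0 m.
  rewrite /wpn; apply: cvg_big => [[x y]|i _]; first exact: mul_continuous.
  apply: cvgM; first by apply: cvgB; [exact: vq0 | exact: cvg_cst].
  apply: cvgV; first by rewrite mulr0 mul0r subr0 oner_neq0.
  apply: cvgB; first exact: cvg_cst.
  by apply: cvgMr_tmp; apply: cvgMl_tmp; exact: vq0.
case: n => m /=; first exact: nat_case.
apply: cvgMl_tmp; rewrite mulr0.
by under eq_fun do rewrite mulrA; exact: nat_case.
Qed.

Lemma cvg_wp4_param a v1 v2 v3 v4 n :
  (fun N => wp4 a v1 v2 v3 (v4 * q ^+ N) n) @ \oo --> wp4 a v1 v2 v3 0 n.
Proof. by apply: cvgMl_tmp; apply: cvgMl_tmp; exact: cvg_wp_param. Qed.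

(** The majorant needed to send the fourth parameter to infinity. For large m and N0 the numerator
    v4 q^(N+N0) - q^m is small uniformly in N, while the other factors of the ratio stay bounded. *)
Lemma wp4_geom_unif a v1 v2 v3 v4 : exists (C r : R) (N0 : nat), 0 <= r < 1 /\
  forall N m, cabs (wp4 a v1 v2 v3 (v4 * q ^+ (N + N0)) m%:Z) <= C * r ^+ m.
Proof.
pose rho (m : nat) := a ^+ 2
    * ((v1 - q ^+ m) / (1 - a * v1 * q ^+ m.+1))
    * ((v2 - q ^+ m) / (1 - a * v2 * q ^+ m.+1))
    * ((v3 - q ^+ m) / (1 - a * v3 * q ^+ m.+1)).
have rhow : rho @ \oo --> a ^+ 2 * v1 * v2 * v3.
  by do 2![apply: cvgM; last exact: cvg_wp_factor]; apply: cvgMl_tmp;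
    exact: cvg_wp_factor.
have [B hB] := cvg_bounded rhow.
have B0 : 0 <= B by exact: le_trans (cabs_ge0 _) (hB 0%N).
have q0 := cabs_ge0 q.
have small (c d : R) : 0 < d -> exists m0 : nat, forall m, (m0 <= m)%N ->
    c * cabs q ^+ m <= d.
  move=> d0; have := @cvg_geom R c (cabs q).
  rewrite q0 q_lt1 => /(_ isT)/cvgrPdist_lt/(_ _ d0)[m0 _ hm0].
  exists m0 => m /hm0 /=; rewrite sub0r normrN => hm.
  exact: le_trans (ler_norm _) (ltW hm).
(* Both parts of the numerator will be at most [d] and the denominator at least 1/2, so the ratio is
   at most 4 B d <= 1/2. *)
pose d := 1 / (8 * (B + 1)).
have B10 : 0 < B + 1 by rewrite ltr_wpDl.
have d0 : 0 < d by rewrite divr_gt0 // mulr_gt0.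
have [N0 hN0] := small (cabs v4) d d0.
have [n1 hn1] := small 1 d d0.
have [n2 hn2] := small (cabs (a * v4)) (1 / 2) ltac:(lra).
have [||C hC] := @ratio_geom R (fun N m => wp4 a v1 v2 v3 (v4 * q ^+ (N + N0)) m%:Z)
  (1 / 2) (maxn n1 n2) ltac:(lra).
(* For fixed n the terms converge as N grows, hence are bounded in N. *)
- move=> n; have := @cvg_wp4_param a v1 v2 v3 v4 n%:Z.
  by rewrite -(cvg_shiftn N0) => /cvg_bounded.
- move=> N n; rewrite geq_max => /andP[n1n n2n].
  rewrite wp4S -/(rho n) cabsM mulrC ler_wpM2r ?cabs_ge0 // (cabsM (rho n)).
  rewrite (cabsM (_ - _)) cabsV; set D := 1 - a * (v4 * q ^+ (N + N0)) * _.
  have D2 : 1 / 2 <= cabs D.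
    apply: le_trans _ (cabs_lerB _ _); rewrite cabs1 lerBrDl -lerBrDr.
    rewrite (_ : a * (v4 * q ^+ (N + N0)) * q ^+ n.+1 =
      (a * v4 * q ^+ n) * (q ^+ (N + N0).+1)); last by rewrite !exprS; ring.
    rewrite cabsM.
    have le1 : cabs (q ^+ (N + N0).+1) <= 1 by rewrite cabsX exprn_ile1 // ltW.
    have := hn2 n n2n; rewrite -cabsX -cabsM => h2.
    apply: le_trans (ler_piMr (cabs_ge0 _) le1) _; lra.
  have Dgt : 0 < cabs D by lra.
  have E : cabs (v4 * q ^+ (N + N0) - q ^+ n) <= d + d.
    apply: le_trans (cabsB _ _) _; apply: lerD.
      by rewrite cabsM cabsX hN0 // leq_addl.
    by rewrite cabsX -[X in X <= _]mul1r hn1.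
  rewrite mulrA ler_pdivrMr //.
  apply: (@le_trans _ _ (B * (d + d))); first by rewrite ler_pM ?cabs_ge0.
  apply: (@le_trans _ _ (1 / 4)); last by lra.
  have -> : B * (d + d) = (B / (B + 1)) * (1 / 4) by rewrite /d; field; rewrite gt_eqF.
  by rewrite ler_piMl ?divr_ge0 // ler_pdivrMr // mul1r lerDl.
by exists C, (1 / 2), N0; split; [lra | exact: hC].
Qed.

End WellPoised.

(** * Bailey's bilateral 6psi6 sum, reduced to a theta series *)

Section SixPsiSix.
Variable R : realType.
Local Notation K := (Cfield R).
Variable q : K.
Hypotheses (q_neq0 : q != 0) (q_lt1 : cabs q < 1).
Implicit Types (a v x : K) (m N : nat) (n : int).

Local Notation wp4 := (wp4 q).
Local Notation regular := (wp_regular q).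
Local Notation I x := (qpoch_inf x q).

Lemma geom_max (x C1 C2 r1 r2 : R) m : 0 <= C1 -> 0 <= r1 -> x <= C1 * r1 ^+ m ->
  x <= Num.max C1 C2 * Num.max r1 r2 ^+ m.
Proof.
move=> C0 r0 h; apply: (le_trans h); apply: ler_pM => //.
- exact: exprn_ge0.
- by rewrite le_max lexx.
- by rewrite lerXn2r ?nnegrE ?le_max ?r0 ?lexx.
Qed.

(** Here [f2] is the reflected family, whose factor q^(4m) pays for the weight p at q^(-m). The
    index N lets the same bound serve one series and a limit of series. *)
Lemma two_sided_geom (f : nat -> int -> K) (f1 f2 : nat -> nat -> K) (p : K -> K) :
  quartic p ->
  (forall N m, f N m%:Z = f1 N m) ->
  (forall N m, f N (- m%:Z) = (q ^+ m) ^+ 4 * f2 N m) ->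
  (exists C r : R, 0 <= r < 1 /\ forall N m, cabs (f1 N m) <= C * r ^+ m) ->
  (exists C r : R, 0 <= r < 1 /\ forall N m, cabs (f2 N m) <= C * r ^+ m) ->
  exists C r : R, 0 <= r < 1 /\ forall N m,
    cabs (f N m%:Z * p (q ^ m%:Z)) <= C * r ^+ m /\
    cabs (f N (- m%:Z) * p (q ^ (- m%:Z))) <= C * r ^+ m.
Proof.
move=> pq e1 e2 [C1 [r1 [/andP[r10 r11] h1]]] [C2 [r2 [/andP[r20 r21] h2]]].
have [B [B0 hB]] := quartic_bound q_neq0 q_lt1 pq.
have C10 : 0 <= C1.
  by have := le_trans (cabs_ge0 _) (h1 0%N 0%N); rewrite expr0 mulr1.
have C20 : 0 <= C2.
  by have := le_trans (cabs_ge0 _) (h2 0%N 0%N); rewrite expr0 mulr1.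
exists (Num.max C1 C2 * B), (Num.max r1 r2); split.
  by rewrite le_max r10 gt_max r11 r21.
move=> N m; have [hp hn] := hB m; rewrite mulrAC; split.
  by rewrite cabsM e1 ler_pM ?cabs_ge0 ?geom_max.
rewrite e2 [_ * f2 N m]mulrC -[f2 N m * _ * _]mulrA cabsM ler_pM ?cabs_ge0 //.
by rewrite maxC [X in _ * X ^+ _]maxC geom_max.
Qed.

Section Summation.
Variables a v1 v2 v3 v4 : K.
Hypotheses (a_neq0 : a != 0) (reg1 : regular a v1) (reg2 : regular a v2).
Hypotheses (reg3 : regular a v3) (reg4 : regular a v4).
Hypothesis conv : cabs (a ^+ 2 * v1 * v2 * v3 * v4) < 1.
Local Notation W := (wp4 a v1 v2 v3 v4).

Lemma wp4_two_sided (p : K -> K) : quartic p ->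
  exists C r : R, 0 <= r < 1 /\ forall m,
    cabs (W m%:Z * p (q ^ m%:Z)) <= C * r ^+ m /\
    cabs (W (- m%:Z) * p (q ^ (- m%:Z))) <= C * r ^+ m.
Proof.
move=> pq; have [||||C [r [r01 h]]] := @two_sided_geom (fun _ => W)
  (fun _ m => W m%:Z)
  (fun _ m => wp4 a^-1 (a * v1) (a * v2) (a * v3) (a * v4) m%:Z) p pq.
- by [].
- by move=> _ m; exact: wp4_neg.
- by have [C [r [? h]]] := wp4_geom q_lt1 conv; exists C, r; split.
- have conv' : cabs (a^-1 ^+ 2 * (a * v1) * (a * v2) * (a * v3) * (a * v4)) < 1.
    have -> : a^-1 ^+ 2 * (a * v1) * (a * v2) * (a * v3) * (a * v4) =
      a ^+ 2 * v1 * v2 * v3 * v4 by field.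
    exact: conv.
  by have [C [r [? h]]] := wp4_geom q_lt1 conv'; exists C, r; split.
by exists C, r; split=> // m; exact: (h 0%N).
Qed.

Lemma wp4_summable (p : K -> K) : quartic p ->
  bilateral_sum (fun n => W n * p (q ^ n)) (bsum (fun n => W n * p (q ^ n))).
Proof.
move=> /wp4_two_sided[C [r [r01 h]]].
by apply: (@bilateral_sum_geom R _ C r r01) => m; have [h1 h2] := h m;
  [exact: h1 | exact: h2].
Qed.

(** The summand is U(n+1) - U(n), where U(n) is W(n) times the four factors 1 - a v_i q^n: by
    [wp4_step] these clear the denominators of W(n+1). Their product is a quartic in q^n, so U tends
    to 0 at both ends. *)
Lemma wp4_telescope : bilateral_sum
  (fun n => W n * (a ^+ 2 * ((v1 - q ^ n) * (v2 - q ^ n) * (v3 - q ^ n) * (v4 - q ^ n))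
    - (1 - a * v1 * q ^ n) * (1 - a * v2 * q ^ n)
      * (1 - a * v3 * q ^ n) * (1 - a * v4 * q ^ n))) 0.
Proof.
pose p x := (1 - a * v1 * x) * (1 - a * v2 * x) * (1 - a * v3 * x) * (1 - a * v4 * x).
have pq : quartic p.
  exists 1, (- (a * (v1 + v2 + v3 + v4))),
    (a ^+ 2 * (v1 * v2 + v1 * v3 + v1 * v4 + v2 * v3 + v2 * v4 + v3 * v4)),
    (- (a ^+ 3 * (v1 * v2 * v3 + v1 * v2 * v4 + v1 * v3 * v4 + v2 * v3 * v4))),
    (a ^+ 4 * (v1 * v2 * v3 * v4)) => x.
  by rewrite /p; ring.
have [C [r [r01 h]]] := wp4_two_sided pq.
have := @bilateral_sum_telescope R (fun n => W n * p (q ^ n)).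
have U1 : (fun m : nat => W m%:Z * p (q ^ m%:Z)) @ \oo --> (0 : K).
  by apply: cvg_squeeze0 (cvg_geom C r01) => m; have [] := h m.
have U2 : (fun m : nat => W (- m%:Z) * p (q ^ (- m%:Z))) @ \oo --> (0 : K).
  by apply: cvg_squeeze0 (cvg_geom C r01) => m; have [] := h m.
move=> /(_ U1 U2); congr (bilateral_sum _ _); apply/funext => n.
rewrite mulrBr -(wp4_step q_neq0 n a_neq0 reg1 reg2 reg3 reg4) /p.
rewrite expfzDr // expr1z -!(mulrA _ q) ![q * q ^ n]mulrC.
by [].
Qed.

End Summation.

(** Bailey's very-well-poised 6psi6 series multiplied by 1 - a, which keeps a = 1 admissible; its
    argument is a^2 v1 v2 v3 v4 q. *)
Definition psi a v1 v2 v3 v4 : K :=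
  bsum (fun n => wp4 a v1 v2 v3 v4 n * (q ^ n * (1 - a * (q ^ n) ^+ 2))).

(** Brings each parameter in turn to the last place, where [psi_limit] acts. *)
Lemma psi_rot a v1 v2 v3 v4 : psi a v1 v2 v3 v4 = psi a v4 v1 v2 v3.
Proof.
rewrite /psi; congr bsum; apply/funext => n; rewrite /wp4; congr (_ * _ * _).
by rewrite -!mulrA mulrC -!mulrA mulrC -!mulrA mulrC -!mulrA.
Qed.

Lemma quartic_psi a : quartic (fun x => x * (1 - a * x ^+ 2)).
Proof. by exists 0, 1, 0, (- a), 0 => x; ring. Qed.

(** By [wp4_shift] the summand at v4 is the term at v4 q times a polynomial in q^n, and this
    polynomial is a combination of the very-well-poised weight and the telescoping one. Summability
    at v4 is inherited from v4 q, so the bound with the extra factor q suffices. *)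
Lemma psi_step a v1 v2 v3 v4 : a != 0 ->
  regular a v1 -> regular a v2 -> regular a v3 -> regular a v4 ->
  cabs (a ^+ 2 * v1 * v2 * v3 * v4 * q) < 1 ->
  bilateral_sum (fun n => wp4 a v1 v2 v3 v4 n * (q ^ n * (1 - a * (q ^ n) ^+ 2)))
    (psi a v1 v2 v3 v4) /\
  psi a v1 v2 v3 v4 * ((1 - v4 * q) * (1 - a * v4 * q)
      * (1 - a ^+ 2 * v1 * v2 * v3 * v4 * q)) =
    (1 - a * v1 * v4 * q) * (1 - a * v2 * v4 * q) * (1 - a * v3 * v4 * q)
      * psi a v1 v2 v3 (v4 * q).
Proof.
move=> a0 r1 r2 r3 r4 cv.
have r4' : regular a (v4 * q) by have := wp_regularM 1 r4; rewrite expr1.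
have cv' : cabs (a ^+ 2 * v1 * v2 * v3 * (v4 * q)) < 1 by rewrite mulrA.
have S' := wp4_summable a0 cv' (quartic_psi a).
have T' := wp4_telescope a0 r1 r2 r3 r4' cv'.
have [d1 d2] := r4 0%N; rewrite expr1 in d1 d2.
have d3 : 1 - a ^+ 2 * v1 * v2 * v3 * v4 * q != 0.
  rewrite subr_eq0; apply: contraTneq cv => <-.
  by rewrite cabs1 ltxx.
set D := (1 - v4 * q) * (1 - a * v4 * q) * (1 - a ^+ 2 * v1 * v2 * v3 * v4 * q).
have D0 : D != 0 by rewrite !mulf_neq0.
pose A := (1 - a * v1 * v4 * q) * (1 - a * v2 * v4 * q) * (1 - a * v3 * v4 * q).
have := bilateral_sum_lin (A / D) (v4 * q / D) S' T'.
rewrite mulr0 addr0 -/(psi _ _ _ _ _) => L.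
have fE : (fun n => A / D * (wp4 a v1 v2 v3 (v4 * q) n
    * (q ^ n * (1 - a * (q ^ n) ^+ 2))) + v4 * q / D *
    (wp4 a v1 v2 v3 (v4 * q) n *
    (a ^+ 2 * ((v1 - q ^ n) * (v2 - q ^ n) * (v3 - q ^ n) * (v4 * q - q ^ n))
    - (1 - a * v1 * q ^ n) * (1 - a * v2 * q ^ n)
      * (1 - a * v3 * q ^ n) * (1 - a * (v4 * q) * q ^ n)))) =
  (fun n => wp4 a v1 v2 v3 v4 n * (q ^ n * (1 - a * (q ^ n) ^+ 2))).
  apply/funext => n; apply: (mulIf D0).
  have := wp4_shift q_neq0 v1 v2 v3 n a0 r4.
  set w := wp4 a v1 v2 v3 v4 n; set w' := wp4 a v1 v2 v3 (v4 * q) n; set x := q ^ n => E.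
  have -> : w * (x * (1 - a * x ^+ 2)) * D =
     (w * ((1 - v4 * q) * (1 - a * v4 * q)) * x) * ((1 - a * x ^+ 2)
       * (1 - a ^+ 2 * v1 * v2 * v3 * v4 * q)) by rewrite /D; ring.
  rewrite E mulrDl.
  have cancel (y z : K) : y / D * z * D = y * z by field.
  by rewrite !cancel /A; ring.
rewrite fE in L; rewrite {1 2}/psi (bsumE L); split; first exact: L.
by rewrite -/D mulrAC divfK.
Qed.

Lemma cvg_psi a v1 v2 v3 v4 : a != 0 ->
  (fun N => psi a v1 v2 v3 (v4 * q ^+ N)) @ \oo --> psi a v1 v2 v3 0.
Proof.
move=> a0.
have [C1 [r1 [N1 [r101 h1]]]] := wp4_geom_unif q_lt1 a v1 v2 v3 v4.
have [C2 [r2 [N2 [r201 h2]]]] :=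
  wp4_geom_unif q_lt1 a^-1 (a * v1) (a * v2) (a * v3) (a * v4).
(* [N1] serves the forward terms and [N2] the reflected ones; the shift by their sum serves both. *)
have [||||C [r [r01 h]]] := @two_sided_geom
  (fun N => wp4 a v1 v2 v3 (v4 * q ^+ (N + (N1 + N2))))
  (fun N m => wp4 a v1 v2 v3 (v4 * q ^+ (N + (N1 + N2))) m%:Z)
  (fun N m => wp4 a^-1 (a * v1) (a * v2) (a * v3)
    (a * v4 * q ^+ (N + (N1 + N2))) m%:Z) _ (quartic_psi a).
- by [].
- by move=> N m; rewrite wp4_neg mulrA.
- by exists C1, r1; split=> // N m; have := h1 (N + N2)%N m; rewrite -addnA (addnC N2).
- by exists C2, r2; split=> // N m; have := h2 (N + N1)%N m; rewrite -addnA.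
rewrite -(cvg_shiftn (N1 + N2)); apply: (@bsum_tannery R _ _ C r r01) => [n|N m|N m].
- apply: cvgMr_tmp; have := @cvg_wp4_param R q q_lt1 a v1 v2 v3 v4 n.
  by rewrite -(cvg_shiftn (N1 + N2)).
- by have [hh _] := h N m; exact: hh.
- by have [_ hh] := h N m; exact: hh.
Qed.

(** N uses of [psi_step] replace v4 by v4 q^N and build up partial products; letting N grow turns
    these into infinite products and v4 into 0. *)
Lemma psi_limit a v1 v2 v3 v4 : a != 0 ->
  regular a v1 -> regular a v2 -> regular a v3 -> regular a v4 ->
  cabs (a ^+ 2 * v1 * v2 * v3 * v4 * q) < 1 ->
  psi a v1 v2 v3 v4 * (I (v4 * q) * I (a * v4 * q)
      * I (a ^+ 2 * v1 * v2 * v3 * v4 * q)) =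
    I (a * v1 * v4 * q) * I (a * v2 * v4 * q) * I (a * v3 * v4 * q)
      * psi a v1 v2 v3 0.
Proof.
move=> a0 r1 r2 r3 r4 cv.
pose P x N := \prod_(i < N) (1 - x * q ^+ i).
have iter N : psi a v1 v2 v3 v4 * (P (v4 * q) N * P (a * v4 * q) N
      * P (a ^+ 2 * v1 * v2 * v3 * v4 * q) N) =
    P (a * v1 * v4 * q) N * P (a * v2 * v4 * q) N * P (a * v3 * v4 * q) N
      * psi a v1 v2 v3 (v4 * q ^+ N).
  elim: N => [|N IH]; first by rewrite /P !big_ord0 expr0 !(mulr1, mul1r).
  have cvN : cabs (a ^+ 2 * v1 * v2 * v3 * (v4 * q ^+ N) * q) < 1.
    rewrite mulrA mulrAC cabsM; apply: le_lt_trans cv.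
    by rewrite ler_piMr ?cabs_ge0 // cabsX exprn_ile1 ?cabs_ge0 // ltW.
  have [_ E] := psi_step a0 r1 r2 r3 (wp_regularM N r4) cvN.
  have PS x : P x N.+1 = P x N * (1 - x * q ^+ N) by rewrite /P big_ord_recr.
  rewrite !PS (exprSr q N) (mulrA v4).
  set X := psi a v1 v2 v3 (v4 * q ^+ N) in IH E.
  set Y := psi a v1 v2 v3 (v4 * q ^+ N * q) in E *.
  set Z := psi a v1 v2 v3 v4 in IH *; set Q := q ^+ N in E *.
  set p1 := P (v4 * q) N in IH *; set p2 := P (a * v4 * q) N in IH *.
  set p3 := P (a ^+ 2 * v1 * v2 * v3 * v4 * q) N in IH *.
  set p4 := P (a * v1 * v4 * q) N in IH *; set p5 := P (a * v2 * v4 * q) N in IH *.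
  set p6 := P (a * v3 * v4 * q) N in IH *.
  have -> : Z * (p1 * (1 - v4 * q * Q) * (p2 * (1 - a * v4 * q * Q)) *
      (p3 * (1 - a ^+ 2 * v1 * v2 * v3 * v4 * q * Q))) =
    (Z * (p1 * p2 * p3)) * ((1 - v4 * Q * q) * (1 - a * (v4 * Q) * q)
      * (1 - a ^+ 2 * v1 * v2 * v3 * (v4 * Q) * q)) by ring.
  by rewrite IH -(mulrA (p4 * p5 * p6) X) E; ring.
have Pc x : P x @ \oo --> I x by exact: cvg_qpoch_inf.
have L : (fun N => psi a v1 v2 v3 v4 * (P (v4 * q) N * P (a * v4 * q) N
      * P (a ^+ 2 * v1 * v2 * v3 * v4 * q) N)) @ \oo -->
  psi a v1 v2 v3 v4 * (I (v4 * q) * I (a * v4 * q)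
      * I (a ^+ 2 * v1 * v2 * v3 * v4 * q)).
  apply: cvgMl_tmp; apply: cvgM; last exact: Pc.
  by apply: cvgM; exact: Pc.
apply: (cvgc_unique L); under eq_fun do rewrite iter.
apply: cvgM; last exact: cvg_psi.
apply: cvgM; last exact: Pc.
by apply: cvgM; exact: Pc.
Qed.

Lemma qpoch_inf0 : I 0 = 1.
Proof.
apply: qpoch_inf_eq.
have -> : (fun n : nat => \prod_(i < n) (1 - 0 * q ^+ i)) = fun=> 1 :> K.
  by apply/funext => n; rewrite big1 // => i _; rewrite mul0r subr0.
exact: cvg_cst.
Qed.

(** Four uses of [psi_limit], sending v4, v3, v2, v1 to 0. The pair product I(a v_i v_j q) with i <
    j appears when v_j is removed. *)
Lemma psi_theta a v1 v2 v3 v4 : a != 0 ->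
  regular a v1 -> regular a v2 -> regular a v3 -> regular a v4 ->
  cabs (a ^+ 2 * v1 * v2 * v3 * v4 * q) < 1 ->
  psi a v1 v2 v3 v4 * (I (v1 * q) * I (v2 * q) * I (v3 * q) * I (v4 * q)
      * (I (a * v1 * q) * I (a * v2 * q) * I (a * v3 * q) * I (a * v4 * q))
      * I (a ^+ 2 * v1 * v2 * v3 * v4 * q)) =
    I (a * v1 * v2 * q) * I (a * v1 * v3 * q) * I (a * v1 * v4 * q)
      * (I (a * v2 * v3 * q) * I (a * v2 * v4 * q) * I (a * v3 * v4 * q))
      * psi a 0 0 0 0.
Proof.
move=> a0 r1 r2 r3 r4 cv; have r0 := @wp_regular0 R q a.
have c0 : cabs (0 : K) < 1 by rewrite cabs0 ltr01.
have z1 x : a * 0 * x * q = 0 by rewrite mulr0 !mul0r.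
have z2 x y z : a ^+ 2 * 0 * x * y * z * q = 0 by rewrite mulr0 !mul0r.
(* The ones are values [I 0], coming from parameters that are already 0. *)
have s1 (p x y p' : K) : p * (x * y * 1) = 1 * 1 * 1 * p' -> p * (x * y) = p'.
  by rewrite mulr1 !mul1r.
have s2 (p x y z p' : K) :
  p * (x * y * 1) = 1 * 1 * z * p' -> p * (x * y) = z * p' by rewrite mulr1 !mul1r.
have s3 (p x y z w p' : K) :
  p * (x * y * 1) = 1 * z * w * p' -> p * (x * y) = z * w * p'.
  by rewrite mulr1 !mul1r.
have E1 : psi a 0 0 0 v1 * (I (v1 * q) * I (a * v1 * q)) = psi a 0 0 0 0.
  apply: s1; have := psi_limit a0 r0 r0 r0 r1.
  by rewrite !z1 !z2 qpoch_inf0 => /(_ c0).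
have E2 : psi a 0 0 v1 v2 * (I (v2 * q) * I (a * v2 * q)) =
    I (a * v1 * v2 * q) * psi a 0 0 0 v1.
  apply: s2; rewrite -[psi a 0 0 0 v1]psi_rot; have := psi_limit a0 r0 r0 r1 r2.
  by rewrite !z1 !z2 qpoch_inf0 => /(_ c0).
have E3 : psi a 0 v1 v2 v3 * (I (v3 * q) * I (a * v3 * q)) =
    I (a * v1 * v3 * q) * I (a * v2 * v3 * q) * psi a 0 0 v1 v2.
  apply: s3; rewrite -[psi a 0 0 v1 v2]psi_rot; have := psi_limit a0 r0 r1 r2 r3.
  by rewrite !z1 !z2 qpoch_inf0 => /(_ c0).
have E4 := psi_limit a0 r1 r2 r3 r4 cv; rewrite [psi a v1 v2 v3 0]psi_rot in E4.
have chain (p4 p3 p2 p1 p0 x1 y1 x2 y2 x3 y3 x4 y4 w c12 c13 c14 c23 c24 c34 : K) :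
  p1 * (x1 * y1) = p0 -> p2 * (x2 * y2) = c12 * p1 ->
  p3 * (x3 * y3) = c13 * c23 * p2 -> p4 * (x4 * y4 * w) = c14 * c24 * c34 * p3 ->
  p4 * (x1 * x2 * x3 * x4 * (y1 * y2 * y3 * y4) * w) =
    c12 * c13 * c14 * (c23 * c24 * c34) * p0.
  move=> h1 h2 h3 h4.
  have -> : p4 * (x1 * x2 * x3 * x4 * (y1 * y2 * y3 * y4) * w) =
    p4 * (x4 * y4 * w) * (x3 * y3 * (x2 * y2) * (x1 * y1)) by ring.
  rewrite h4; have -> : c14 * c24 * c34 * p3 * (x3 * y3 * (x2 * y2) * (x1 * y1)) =
    c14 * c24 * c34 * (p3 * (x3 * y3)) * ((x2 * y2) * (x1 * y1)) by ring.
  rewrite h3; have -> : c14 * c24 * c34 * (c13 * c23 * p2) * ((x2 * y2) * (x1 * y1)) =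
    c14 * c24 * c34 * c13 * c23 * (p2 * (x2 * y2)) * (x1 * y1) by ring.
  by rewrite h2 -h1; ring.
exact: chain E1 E2 E3 E4.
Qed.

End SixPsiSix.

(** * Evaluation of the theta series *)

Section ThetaFunction.
Variable R : realType.
Local Notation K := (Cfield R).
Variable q : K.
Hypotheses (q_neq0 : q != 0) (q_lt1 : cabs q < 1).
Implicit Types (a v x : K) (m N : nat) (n k : int).

Local Notation I x := (qpoch_inf x q).

(** The value itself is (-1)^n q^(n(n-1)/2); squaring removes the sign and the halved exponent, and
    [wp4] at 0 contains the square twice. *)
Lemma wp_at0_sqr a n : wp q a 0 n ^+ 2 = q ^ (n * (n - 1)).
Proof.
have natE b m : wpn q b 0 m ^+ 2 = q ^ (m%:Z * (m%:Z - 1)).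
  elim: m => [|m IH]; first by rewrite /wpn big_ord0 expr1n mul0r expr0z.
  rewrite wpnS exprMn IH mulr0 mul0r subr0 divr1 sub0r sqrrN.
  have -> : m.+1%:Z * (m.+1%:Z - 1) = m%:Z * (m%:Z - 1) + (m%:Z + m%:Z).
    by rewrite intS; ring.
  by rewrite !expfzDr // -exprnP expr2.
case: n => m; first exact: natE.
rewrite NegzE wp_neg mulr0 exprMn natE.
set z := m.+1%:Z; have -> : - z * (- z - 1) = (z + z) + z * (z - 1) by ring.
by rewrite !expfzDr // /z -exprnP expr2.
Qed.

Lemma psi0_summable a : a != 0 -> bilateral_sum
  (fun n => wp4 q a 0 0 0 0 n * (q ^ n * (1 - a * (q ^ n) ^+ 2))) (psi q a 0 0 0 0).
Proof.
move=> a0; apply: (wp4_summable q_neq0 q_lt1 a0 _ (quartic_psi a)).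
by rewrite mulr0 cabs0.
Qed.

(* For a = q^k the terms at n and -k-n are opposite. *)
Lemma psi0_qpow k : psi q (q ^ k) 0 0 0 0 = 0.
Proof.
set a := q ^ k; have a0 : a != 0 by rewrite expfz_neq0.
have S := psi0_summable a0.
set f := (fun n => _) in S.
have fE n : f n = q ^ (2 * k * n + 2 * (n * n) - n)
    - q ^ (2 * k * n + 2 * (n * n) + n + k).
  rewrite /f /wp4; have -> : wp q a 0 n * wp q a 0 n * wp q a 0 n * wp q a 0 n =
    (wp q a 0 n ^+ 2) * (wp q a 0 n ^+ 2) by ring.
  have D (x y : int) : q ^ (x + y) = q ^ x * q ^ y by rewrite expfzDr.
  have -> : (a ^+ 2) ^ n = q ^ ((k + k) * n) by rewrite /a expr2 -D exprz_exp.
  rewrite wp_at0_sqr [(q ^ n) ^+ 2]expr2.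
  have -> : 2 * k * n + 2 * (n * n) - n =
    (k + k) * n + (n * (n - 1) + n * (n - 1)) + n by ring.
  have -> : 2 * k * n + 2 * (n * n) + n + k =
    (k + k) * n + (n * (n - 1) + n * (n - 1)) + n + (k + (n + n)) by ring.
  rewrite !D; move: (q ^ _) (q ^ _) (q ^ _) => x y z; rewrite /a.
  by move: (q ^ k) => t; ring.
have := bilateral_sum_shiftz k (bilateral_sum_opp S).
have -> : (fun n => f (- (n + k))) = (fun n => -1 * f n).
  apply/funext => n; rewrite !fE mulN1r opprB.
  by congr (q ^ _ - q ^ _); ring.
move=> /(bilateral_sum_unique (bilateral_sumZ (-1) S)).
by move/eqP; rewrite mulN1r eq_sym -addr_eq0 -mulr2n mulrn_eq0 /= => /eqP.
Qed.

Lemma psi0_generic a : a != 0 -> (forall k : nat, 1 - a * q ^+ k.+1 != 0) ->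
  (forall k : nat, 1 - a^-1 * q ^+ k.+1 != 0) ->
  psi q a 0 0 0 0 = (1 - a) * I q * I (a * q) * I (a^-1 * q).
Proof.
move=> a0 ra rV.
have rq (k : nat) : 1 - q ^+ k.+1 != 0.
  rewrite subr_eq0; apply/eqP => h.
  have : cabs (q ^+ k.+1) < 1 by rewrite cabsX exprn_ilt1 ?cabs_ge0.
  by rewrite -h cabs1 ltxx.
have r1 : wp_regular q a 1 by move=> k; rewrite mul1r mulr1.
have r2 : wp_regular q a a^-1 by move=> k; rewrite divff // mul1r.
have r0 := @wp_regular0 R q a.
have c0 : cabs (a ^+ 2 * 1 * a^-1 * 0 * 0 * q) < 1.
  by rewrite mulr0 mul0r cabs0.
have := psi_theta q_neq0 q_lt1 a0 r1 r2 r0 r0 c0.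
(* The parameter v1 = 1 kills every n > 0 through its factor 1 - q^0. Under reflection v2 = 1/a
   becomes 1 and kills every n < 0 in the same way. *)
have single : psi q a 1 a^-1 0 0 = 1 - a.
  apply: bsumE; exists (1 - a), 0; split; last by rewrite addr0.
    rewrite -(cvg_shiftn 1).
    rewrite (_ : (fun i => _) = fun=> 1 - a); first exact: cvg_cst.
    apply/funext => m; rewrite /series /= addn1 big_nat_recl // big1 => [|i _].
      rewrite addr0 /wp4 /wp /wpn !big_ord0 expr0z; ring.
    rewrite /wp4 /= {1}/wpn big_ord_recl /= expr0 subrr !mul0r mulr0; ring.
  rewrite (_ : series _ = fun=> 0); first exact: cvg_cst.
  apply/funext => m; rewrite /series /= big1 // => i _.
  rewrite /wp4 !wp_neg divff // {2}/wpn big_ord_recl /= expr0 subrr !mul0r; ring.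
have z x : x * 0 * q = 0 by rewrite mulr0 mul0r.
rewrite single !z (mul0r q) !(mulr1 a) (divff a0) (mul1r q) (qpoch_inf0 q).
have Iq : I q != 0.
  by apply: (qpoch_inf_neq0 q_lt1) => k; rewrite -exprS.
(* Here y is [I q]: it occurs twice on the left and once on the right, so one copy survives. *)
have cancel (x y z' w p : K) : y != 0 ->
    x * (y * z' * 1 * 1 * (w * y * 1 * 1) * 1) = y * 1 * 1 * (1 * 1 * 1) * p ->
    p = x * y * w * z'.
  move=> y0 h; apply: (mulfI y0); transitivity (y * 1 * 1 * (1 * 1 * 1) * p).
    by ring.
  by rewrite -h; ring.
exact: cancel.
Qed.

(** When a = q^k with k nonzero, one of the last two products vanishes, and so does the series. All
    other a, including a = 1, fall under [psi0_generic]. *)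
Lemma psi0E a : a != 0 ->
  psi q a 0 0 0 0 = (1 - a) * I q * I (a * q) * I (a^-1 * q).
Proof.
move=> a0.
have Iroot x (k : nat) : 1 - x * q ^+ k.+1 = 0 -> I (x * q) = 0.
  move=> /eqP; rewrite subr_eq0 eq_sym => /eqP h.
  by apply: (@qpoch_inf_root R q q_lt1 _ k); rewrite -mulrA -exprS.
have [[k hk]|n1] := pselect (exists k : nat, 1 - a * q ^+ k.+1 = 0).
  rewrite (Iroot _ _ hk) mulr0 mul0r.
  have -> : a = q ^ (- k.+1%:Z); last exact: psi0_qpow.
  move/eqP: hk; rewrite subr_eq0 => /eqP hk; rewrite -exprnN.
  by rewrite -[LHS](mulfK (expf_neq0 k.+1 q_neq0)) -hk mul1r.
have [[k hk]|n2] := pselect (exists k : nat, 1 - a^-1 * q ^+ k.+1 = 0).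
  rewrite (Iroot _ _ hk) mulr0.
  have -> : a = q ^ k.+1%:Z; last exact: psi0_qpow.
  move/eqP: hk; rewrite subr_eq0 => /eqP hk; rewrite -exprnP.
  by rewrite -[RHS](mulVKf a0) -hk mulr1.
by apply: psi0_generic => // k; apply/eqP => h; [apply: n1 | apply: n2]; exists k.
Qed.

End ThetaFunction.

(** * Finite q-Pochhammer symbols in bases q and q^2 *)

Section QPochhammer.
Variables (F : numFieldType) (q : F).
Hypothesis q_neq0 : q != 0.
Implicit Types (x a c p : F) (n : int).

Lemma qpochs2 x y n : qpochs [:: x; y] q n = qpoch x q n * qpoch y q n.
Proof. by rewrite /qpochs !big_cons big_nil mulr1. Qed.

Lemma qpochs3 x y z n :
  qpochs [:: x; y; z] q n = qpoch x q n * (qpoch y q n * qpoch z q n).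
Proof. by rewrite /qpochs !big_cons big_nil mulr1. Qed.

Lemma qpochs_inf2 x y : qpochs_inf [:: x; y] q = qpoch_inf x q * qpoch_inf y q.
Proof. by rewrite /qpochs_inf !big_cons big_nil mulr1. Qed.

Lemma qpochs_inf5 x1 x2 x3 x4 x5 : qpochs_inf [:: x1; x2; x3; x4; x5] q =
  qpoch_inf x1 q * (qpoch_inf x2 q * (qpoch_inf x3 q
    * (qpoch_inf x4 q * qpoch_inf x5 q))).
Proof. by rewrite /qpochs_inf !big_cons big_nil mulr1. Qed.

Lemma qpoch_sqr c n : qpoch (c ^+ 2) (q ^+ 2) n = qpoch c q n * qpoch (- c) q n.
Proof.
case: n => m /=; last rewrite -invfM; rewrite -big_split /=; [|congr (_^-1)];
  apply: eq_bigr => i _; rewrite [(q ^+ 2) ^+ _]exprAC.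
  by set x := q ^+ _; ring.
by rewrite -exprVn; set x := _^-1; ring.
Qed.

(** The quotient telescopes. In base q^2 with x = a and x = -a it yields the factor (1 - a^2 q^(4n))
    / (1 - a^2) of the mixed-base summand. *)
Lemma qpoch_ratio x n : qpoch_nonzero x q -> qpoch_defined (x * q) q ->
  qpoch (x * q) q n / qpoch x q n = (1 - x * q ^ n) / (1 - x).
Proof.
move=> nz df.
have x1 : 1 - x != 0 by have := nz 0%N; rewrite expr0 mulr1.
apply/eqP; case: n => m /=.
  rewrite eqr_div //; last by apply/prodf_neq0 => i _; exact: nz.
  apply/eqP; rewrite -exprnP; elim: m => [|m IH].
    by rewrite !big_ord0 expr0 mulr1 mul1r mulr1.
  rewrite !big_ord_recr /= mulrAC IH exprS; ring.
rewrite invrK NegzE -exprnN mulrC eqr_div //; last by apply/prodf_neq0 => i _; exact: df.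
apply/eqP; elim: m.+1 => [|k IH].
  by rewrite !big_ord0 expr0 invr1 mulr1 mul1r mulr1.
rewrite !big_ord_recr /= mulrAC IH exprS.
have Q0 : q ^+ k != 0 by rewrite expf_neq0.
by field; rewrite q_neq0 Q0.
Qed.

Lemma qpoch_defined_sqr c : qpoch_defined (c ^+ 2) (q ^+ 2) -> qpoch_defined c q.
Proof.
move=> h k; have := h k.
have -> : 1 - c ^+ 2 * (q ^+ 2) ^- k.+1 = (1 - c * q ^- k.+1) * (1 + c * q ^- k.+1).
  by rewrite [(q ^+ 2) ^+ _]exprAC -exprVn; set x := _^-1; ring.
by rewrite mulf_eq0 negb_or => /andP[].
Qed.

Lemma qpoch_nonzero_sqr c : qpoch_nonzero (c ^+ 2) (q ^+ 2) -> qpoch_nonzero c q.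
Proof.
move=> h k; have := h k.
have -> : 1 - c ^+ 2 * (q ^+ 2) ^+ k = (1 - c * q ^+ k) * (1 + c * q ^+ k).
  by rewrite [(q ^+ 2) ^+ _]exprAC; set x := q ^+ k; ring.
by rewrite mulf_eq0 negb_or => /andP[].
Qed.

End QPochhammer.

(** * From the mixed-base series to the 6psi6 sum *)

Section Quadratic.
Variable R : realType.
Local Notation K := (Cfield R).
Variable q : K.
Hypotheses (q_neq0 : q != 0) (q_lt1 : cabs q < 1).
Implicit Types (a c p s t v : K) (n : int).

Lemma qpoch_inf_sqr c :
  qpoch_inf (c ^+ 2) (q ^+ 2) = qpoch_inf c q * qpoch_inf (- c) q.
Proof.
have q2 : cabs (q ^+ 2) < 1 by rewrite cabsX exprn_ilt1 ?cabs_ge0.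
apply: qpoch_inf_eq.
have -> : (fun n : nat => \prod_(i < n) (1 - c ^+ 2 * (q ^+ 2) ^+ i)) =
    (fun n : nat => (\prod_(i < n) (1 - c * q ^+ i)) * \prod_(i < n) (1 - - c * q ^+ i)).
  by apply/funext => n; exact: (qpoch_sqr q c n%:Z).
by apply: cvgM; exact: cvg_qpoch_inf.
Qed.

Lemma wp_regular_qpoch a p : p != 0 ->
  qpoch_defined p q -> qpoch_nonzero (a * q / p) q -> wp_regular q a p^-1.
Proof.
move=> p0 df nz k; split; last first.
  have -> // : 1 - a * p^-1 * q ^+ k.+1 = 1 - a * q / p * q ^+ k.
  by rewrite exprS; ring.
have := df k; have Q0 : q ^+ k.+1 != 0 by rewrite expf_neq0.
rewrite !subr_eq0; apply: contraNneq => h.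
by rewrite -[q ^+ k.+1](mulVKf p0) -h mulr1 divff.
Qed.

(** Each factor 1 - p q^i equals p (1/p - q^i), and the power of 1/p absorbs the p. Both signs of n
    go by induction on the modulus of n. *)
Lemma wp_qpoch a p n : a != 0 -> p != 0 -> qpoch_defined p q ->
  qpoch p q n / qpoch (a * q / p) q n * p^-1 ^ n = wp q a p^-1 n.
Proof.
move=> a0 p0 df; case: n => m.
  rewrite -exprnP /=; elim: m => [|m IH].
    by rewrite /wpn !big_ord0 invr1 !mulr1.
  rewrite wpnS -IH !big_ord_recr /= !exprS invfM.
  have -> : a * p^-1 * (q * q ^+ m) = a * q / p * q ^+ m by ring.
  have -> : p^-1 - q ^+ m = (1 - p * q ^+ m) / p by field.
  by set x := \prod_(i < m) _; set y := \prod_(i < m) _; ring.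
rewrite NegzE wp_neg -exprnN -exprVn invrK /= invrK.
elim: m.+1 => [|k IH]; first by rewrite /wpn !big_ord0 invr1 !mulr1.
rewrite wpnS !big_ord_recr /= invfM mulKf //.
have cross (x y x' y' z u : K) : x * x' * (y * y') * (z * u) =
  x * y * u * (x' * y' * z) by ring.
rewrite (exprS p) cross IH; have Q0 : q ^+ k != 0 by rewrite expf_neq0.
have pQ : p - q ^+ k * q != 0.
  apply: contra (df k); rewrite !subr_eq0 -exprSr eq_sym => /eqP <-.
  by rewrite divff // expf_neq0.
rewrite !exprSr; set W := wpn _ _ _ _; set Q := q ^+ k in pQ Q0 *.
by field; rewrite p0 pQ q_neq0 Q0 -oppr_eq0 opprB.
Qed.

(** For v2 = -v the telescoping polynomial in x = q^n has no x^2 term. Its outer coefficients form a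
    multiple of 1 - a^2 x^4, its odd ones a multiple of x (1 - a x^2). *)
Lemma mixed_base_reduction a v v3 v4 : a != 0 ->
  wp_regular q a v -> wp_regular q a (- v) -> wp_regular q a v3 ->
  wp_regular q a v4 -> cabs (a ^+ 2 * v * - v * v3 * v4) < 1 ->
  bilateral_sum (fun n => wp4 q a v (- v) v3 v4 n * (1 - a ^+ 2 * (q ^ n) ^+ 4))
    (a * (v3 + v4) * (1 + a * v ^+ 2) / (1 + a ^+ 2 * v ^+ 2 * v3 * v4)
      * psi q a v (- v) v3 v4).
Proof.
move=> a0 r1 r2 r3 r4 cv.
(* Otherwise the argument of the series would be 1, against the convergence hypothesis. *)
have d : 1 + a ^+ 2 * v ^+ 2 * v3 * v4 != 0.
  rewrite addrC -[X in _ + X]opprK subr_eq0; apply/eqP => h.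
  move: cv; have -> : a ^+ 2 * v * - v * v3 * v4 = - (a ^+ 2 * v ^+ 2 * v3 * v4) by ring.
  by rewrite h opprK cabs1 ltxx.
have S := wp4_summable q_neq0 q_lt1 a0 cv (quartic_psi a).
have T := wp4_telescope q_neq0 q_lt1 a0 r1 r2 r3 r4 cv.
set D := 1 + _ in d *; set A := a * _ * _.
have := bilateral_sum_lin (A / D) (- D^-1) S T.
rewrite mulr0 addr0 -/(psi _ _ _ _ _ _); congr (bilateral_sum _ _).
apply/funext => n; apply: (mulIf d); rewrite mulrDl.
have c1 (y z : K) : y / D * z * D = y * z by field.
have c2 (z : K) : - D^-1 * z * D = - z by field.
by rewrite c1 c2 /A /D; set w := wp4 _ _ _ _ _ _ _; set x := q ^ n; ring.
Qed.

Lemma mixed_base_summand a c s t n :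
  a != 0 -> c != 0 -> s != 0 -> t != 0 ->
  qpoch_defined (a * q ^+ 2) (q ^+ 2) -> qpoch_defined (- a * q ^+ 2) (q ^+ 2) ->
  qpoch_nonzero a (q ^+ 2) -> qpoch_nonzero (- a) (q ^+ 2) ->
  qpoch_defined c q -> qpoch_defined (- c) q ->
  qpoch_defined s q -> qpoch_defined t q ->
  (qpochs [:: a * q ^+ 2; - a * q ^+ 2; c ^+ 2] (q ^+ 2) n * qpochs [:: s; t] q n)
    / (qpochs [:: a; - a; a ^+ 2 * q ^+ 2 / c ^+ 2] (q ^+ 2) n
       * qpochs [:: a * q / s; a * q / t] q n)
    * (- (a ^+ 2 / (c ^+ 2 * s * t))) ^ n
  = (1 - a ^+ 2)^-1
    * (wp4 q a c^-1 (- c^-1) s^-1 t^-1 n * (1 - a ^+ 2 * (q ^ n) ^+ 4)).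
Proof.
move=> a0 c0 s0 t0 da dNa na nNa dc dNc ds dt.
have q20 : q ^+ 2 != 0 by rewrite expf_neq0.
have Nc0 : - c != 0 by rewrite oppr_eq0.
have a1 : 1 - a != 0 by have := na 0%N; rewrite expr0 mulr1.
have a1' : 1 + a != 0 by have := nNa 0%N; rewrite expr0 mulr1 opprK.
have hc := wp_qpoch n a0 c0 dc; have hNc := wp_qpoch n a0 Nc0 dNc.
have hs := wp_qpoch n a0 s0 ds; have ht := wp_qpoch n a0 t0 dt.
have ha := qpoch_ratio q20 n na da; have hNa := qpoch_ratio q20 n nNa dNa.
rewrite !qpochs3 !qpochs2 qpoch_sqr.
have -> : a ^+ 2 * q ^+ 2 / c ^+ 2 = (a * q / c) ^+ 2 by rewrite !exprMn exprVn.
rewrite qpoch_sqr; have -> : - (a * q / c) = a * q / - c by rewrite invrN mulrN.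
have -> : - (a ^+ 2 / (c ^+ 2 * s * t)) = a ^+ 2 * (c^-1 * ((- c)^-1 * (s^-1 * t^-1))).
  by field; rewrite c0 s0 t0.
rewrite (expfzMl (a ^+ 2)) (expfzMl c^-1) (expfzMl (- c)^-1) (expfzMl s^-1).
have regroup (A1 A2 B1 B2 S T A1' A2' B1' B2' S' T' z z1 z2 z3 z4 r1 r2 w1 w2 w3 w4 : K) :
  A1 / A1' = r1 -> A2 / A2' = r2 -> B1 / B1' * z1 = w1 -> B2 / B2' * z2 = w2 ->
  S / S' * z3 = w3 -> T / T' * z4 = w4 ->
  (A1 * (A2 * (B1 * B2)) * (S * T)) / (A1' * (A2' * (B1' * B2')) * (S' * T'))
    * (z * (z1 * (z2 * (z3 * z4)))) = r1 * r2 * (z * (w1 * w2 * w3 * w4)).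
  by move=> <- <- <- <- <- <-; rewrite !invfM; ring.
rewrite (regroup _ _ _ _ _ _ _ _ _ _ _ _ ((a ^+ 2) ^ n) _ _ _ _ _ _ _ _ _ _
  ha hNa hc hNc hs ht) invrN /wp4 {regroup ha hNa hc hNc hs ht}.
have -> : (q ^+ 2) ^ n = q ^ n * q ^ n by rewrite expr2 expfzMl.
set x := q ^ n; set w := _ ^ n * _.
have a2 : 1 - a ^+ 2 != 0.
  by have -> : 1 - a ^+ 2 = (1 - a) * (1 + a); [ring | rewrite mulf_neq0].
by field; rewrite a2 a1 opprK a1'.
Qed.

Local Notation I x := (qpoch_inf x q).
Local Notation J x := (qpoch_inf x (q ^+ 2)).

(** Combines [psi_theta] with [psi0E]. Products at c and -c pair up into base q^2, and the factors 1
    + a/c^2 and 1 + a^2/(c^2 s t) of the reduction complete two products in base q. *)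
Lemma mixed_base_product a c s t :
  a != 0 -> c != 0 -> s != 0 -> t != 0 -> 1 - a != 0 -> a + 1 != 0 ->
  wp_regular q a c^-1 -> wp_regular q a (- c^-1) ->
  wp_regular q a s^-1 -> wp_regular q a t^-1 ->
  cabs (a ^+ 2 / (c ^+ 2 * s * t)) < 1 ->
  I (q / s) * (I (q / t) * (I (a * q / s)
    * (I (a * q / t) * I (- (a ^+ 2 / (c ^+ 2 * s * t)))))) != 0 ->
  J (a ^+ 2 * q ^+ 2 / c ^+ 2) * J (q ^+ 2 / c ^+ 2) != 0 ->
  (1 - a ^+ 2)^-1 * (a * (s^-1 + t^-1) * (1 + a * c^-1 ^+ 2)
    / (1 + a ^+ 2 * c^-1 ^+ 2 * s^-1 * t^-1) * psi q a c^-1 (- c^-1) s^-1 t^-1) =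
  (a * (s + t)) / ((a + 1) * s * t)
    * ((I q * (I (q / a) * (I (a * q) * (I (a * q / (s * t)) * I (- (a / c ^+ 2)))))
        * (J (a ^+ 2 * q ^+ 2 / (c ^+ 2 * s ^+ 2))
           * J (a ^+ 2 * q ^+ 2 / (c ^+ 2 * t ^+ 2))))
       / (I (q / s) * (I (q / t) * (I (a * q / s)
           * (I (a * q / t) * I (- (a ^+ 2 / (c ^+ 2 * s * t))))))
          * (J (a ^+ 2 * q ^+ 2 / c ^+ 2) * J (q ^+ 2 / c ^+ 2)))).
Proof.
move=> a0 c0 s0 t0 a1 a1' rc rNc rs rt cv.
have cv' : cabs (a ^+ 2 * c^-1 * - c^-1 * s^-1 * t^-1 * q) < 1.
  have -> : a ^+ 2 * c^-1 * - c^-1 * s^-1 * t^-1 * q =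
    - (a ^+ 2 / (c ^+ 2 * s * t) * q) by field; rewrite c0 s0 t0.
  rewrite cabsN cabsM; apply: le_lt_trans cv.
  by rewrite ler_piMr ?cabs_ge0 // ltW.
have := psi_theta q_neq0 q_lt1 a0 rc rNc rs rt cv'; rewrite (psi0E q_neq0 q_lt1 a0).
have Jf x y z : x ^+ 2 = z -> y = - x -> I x * I y = J z.
  by move=> <- ->; rewrite qpoch_inf_sqr.
have f1 : I (c^-1 * q) * I (- c^-1 * q) = J (q ^+ 2 / c ^+ 2).
  by apply: Jf; [field | ring].
have f2 : I (a * c^-1 * q) * I (a * - c^-1 * q) = J (a ^+ 2 * q ^+ 2 / c ^+ 2).
  by apply: Jf; [field | ring].
have f3 : I (a * c^-1 * s^-1 * q) * I (a * - c^-1 * s^-1 * q) =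
    J (a ^+ 2 * q ^+ 2 / (c ^+ 2 * s ^+ 2)).
  by apply: Jf; [field; rewrite c0 s0 | ring].
have f4 : I (a * c^-1 * t^-1 * q) * I (a * - c^-1 * t^-1 * q) =
    J (a ^+ 2 * q ^+ 2 / (c ^+ 2 * t ^+ 2)).
  by apply: Jf; [field; rewrite c0 t0 | ring].
(* Splitting off the first factor of these two products exposes the factors to be matched with the
   reduction. *)
rewrite (qpoch_infS q_lt1 (- (a / c ^+ 2))).
rewrite (qpoch_infS q_lt1 (- (a ^+ 2 / (c ^+ 2 * s * t)))).
have -> : a * c^-1 * - c^-1 * q = - (a / c ^+ 2) * q by field.
have -> : a ^+ 2 * c^-1 * - c^-1 * s^-1 * t^-1 * q =
    - (a ^+ 2 / (c ^+ 2 * s * t)) * q by field; rewrite c0 s0 t0.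
have -> : a * s^-1 * t^-1 * q = a * q / (s * t) by field; rewrite s0 t0.
have -> : a * s^-1 * q = a * q / s by rewrite mulrAC.
have -> : a * t^-1 * q = a * q / t by rewrite mulrAC.
rewrite (mulrC a^-1 q) (mulrC s^-1 q) (mulrC t^-1 q) -f1 -f2 -f3 -f4 !opprK.
(* With the series and all infinite products abstracted, only an identity of rational functions is
   left. *)
move: (psi _ _ _ _ _ _) => P.
move: (I (c^-1 * q)) (I (- c^-1 * q)) (I (a * c^-1 * q)) (I (a * - c^-1 * q)).
move=> I1 I2 I3 I4.
move: (I (a * c^-1 * s^-1 * q)) (I (a * - c^-1 * s^-1 * q)) => I5 I6.
move: (I (a * c^-1 * t^-1 * q)) (I (a * - c^-1 * t^-1 * q)) => I7 I8.
move: (I (- (a / c ^+ 2) * q)) (I (- (a ^+ 2 / (c ^+ 2 * s * t)) * q)) => I9 I10.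
move: (I (a * q / (s * t))) (I (a * q / s)) (I (a * q / t)) => I11 I12 I13.
move: (I q) (I (a * q)) (I (q / a)) (I (q / s)) (I (q / t)) => I14 I15 I16 I17 I18.
set w := a ^+ 2 / (c ^+ 2 * s * t); move=> E.
rewrite !mulf_eq0 !negb_or => /and5P[h17 h18 h12 h13 /andP[hw h10]].
move=> /andP[/andP[h3 h4] /andP[h1 h2]].
have -> : P = I9 * I5 * I7 * (I6 * I8 * I11) * ((1 - a) * I14 * I15 * I16)
    / (I1 * I2 * I17 * I18 * (I3 * I4 * I12 * I13) * I10).
  by rewrite -E mulfK // !mulf_neq0.
have -> : 1 + a ^+ 2 * c^-1 ^+ 2 * s^-1 * t^-1 = 1 + w.
  by rewrite /w; field; rewrite c0 s0 t0.
have -> : 1 - a ^+ 2 = (1 - a) * (a + 1) by ring.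
move: w hw => w hw.
by field; rewrite h1 h2 h3 h4 h10 hw h12 h13 h17 h18 c0 s0 t0 a1 a1'.
Qed.

End Quadratic.

(* The mixed-base bilateral summation formula *)
Local Close Scope complex_scope.
Local Close Scope classical_set_scope.

Theorem theorem1p2 (R : realType) (q a b s t : R[i])
  (q_neq0 : q != 0) (q_lt1 : `|q| < 1)
  (a_neq0 : a != 0) (b_neq0 : b != 0) (s_neq0 : s != 0) (t_neq0 : t != 0)
  (conv : `|a ^+ 2 / (b * s * t)| < 1)
  (lhs_num2 : forall x, x \in [:: a * q ^+ 2; - a * q ^+ 2; b] ->
     qpoch_defined x (q ^+ 2))
  (lhs_num1 : forall x, x \in [:: s; t] -> qpoch_defined x q)
  (lhs_den2 : forall x, x \in [:: a; - a; a ^+ 2 * q ^+ 2 / b] ->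
     qpoch_nonzero x (q ^+ 2))
  (lhs_den1 : forall x, x \in [:: a * q / s; a * q / t] -> qpoch_nonzero x q)
  (rhs_den0 : a + 1 != 0)
  (rhs_den1 : qpochs_inf [:: q / s; q / t; a * q / s; a * q / t;
                             - (a ^+ 2 / (b * s * t))] q != 0)
  (rhs_den2 : qpochs_inf [:: a ^+ 2 * q ^+ 2 / b; q ^+ 2 / b] (q ^+ 2) != 0) :
  bilateral_sum
    (fun n : int =>
       (qpochs [:: a * q ^+ 2; - a * q ^+ 2; b] (q ^+ 2) n * qpochs [:: s; t] q n)
       / (qpochs [:: a; - a; a ^+ 2 * q ^+ 2 / b] (q ^+ 2) n
          * qpochs [:: a * q / s; a * q / t] q n)
       * (- (a ^+ 2 / (b * s * t))) ^ n)
    ((a * (s + t)) / ((a + 1) * s * t)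
     * ((qpochs_inf [:: q; q / a; a * q; a * q / (s * t); - (a / b)] q
         * qpochs_inf [:: a ^+ 2 * q ^+ 2 / (b * s ^+ 2);
                          a ^+ 2 * q ^+ 2 / (b * t ^+ 2)] (q ^+ 2))
        / (qpochs_inf [:: q / s; q / t; a * q / s; a * q / t;
                          - (a ^+ 2 / (b * s * t))] q
           * qpochs_inf [:: a ^+ 2 * q ^+ 2 / b; q ^+ 2 / b] (q ^+ 2)))).
Proof.
(* A square root of b splits each base-q^2 symbol in b into two base-q symbols, at c and -c. *)
have [c cE] : exists c : R[i], b = c ^+ 2 by exists (sqrtc b); rewrite sqr_sqrtc.
subst b; have c_neq0 : c != 0 by apply: contraNneq b_neq0 => ->; rewrite expr0n.
have Nc_neq0 : - c != 0 by rewrite oppr_eq0.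
have q1 : cabs (q : Cfield R) < 1 by rewrite cabs_lt1.
have cv : cabs (a ^+ 2 / (c ^+ 2 * s * t) : Cfield R) < 1 by rewrite cabs_lt1.
have da := lhs_num2 (a * q ^+ 2) ltac:(by rewrite !inE eqxx).
have dNa := lhs_num2 (- a * q ^+ 2) ltac:(by rewrite !inE eqxx orbT).
have dc2 := lhs_num2 (c ^+ 2) ltac:(by rewrite !inE eqxx !orbT).
have ds := lhs_num1 s ltac:(by rewrite !inE eqxx).
have dt := lhs_num1 t ltac:(by rewrite !inE eqxx orbT).
have na := lhs_den2 a ltac:(by rewrite !inE eqxx).
have nNa := lhs_den2 (- a) ltac:(by rewrite !inE eqxx orbT).
have nac2 := lhs_den2 (a ^+ 2 * q ^+ 2 / c ^+ 2) ltac:(by rewrite !inE eqxx !orbT).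
have ns := lhs_den1 (a * q / s) ltac:(by rewrite !inE eqxx).
have nt := lhs_den1 (a * q / t) ltac:(by rewrite !inE eqxx orbT).
(* The base-q^2 conditions on b factor into base-q conditions at c and at -c. *)
have dc : qpoch_defined c q by exact: qpoch_defined_sqr dc2.
have dNc : qpoch_defined (- c) q by apply: qpoch_defined_sqr; rewrite sqrrN.
have nc : qpoch_nonzero (a * q / c) q.
  by apply: qpoch_nonzero_sqr; rewrite !exprMn exprVn.
have nNc : qpoch_nonzero (a * q / - c) q.
  by apply: qpoch_nonzero_sqr; rewrite !exprMn exprVn sqrrN.
have rc := @wp_regular_qpoch R q q_neq0 a c c_neq0 dc nc.
have rNc := @wp_regular_qpoch R q q_neq0 a (- c) Nc_neq0 dNc nNc.
have rs := @wp_regular_qpoch R q q_neq0 a s s_neq0 ds ns.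
have rt := @wp_regular_qpoch R q q_neq0 a t t_neq0 dt nt.
rewrite invrN in rNc.
have a1 : 1 - a != 0 by have := na 0%N; rewrite expr0 mulr1.
have cv' : cabs (a ^+ 2 * c^-1 * - c^-1 * s^-1 * t^-1 : Cfield R) < 1.
  have -> : a ^+ 2 * c^-1 * - c^-1 * s^-1 * t^-1 = - (a ^+ 2 / (c ^+ 2 * s * t)).
    by field; rewrite c_neq0 s_neq0 t_neq0.
  by rewrite cabsN.
have S := bilateral_sumZ (1 - a ^+ 2)^-1
  (@mixed_base_reduction R q q_neq0 q1 a c^-1 s^-1 t^-1 a_neq0 rc rNc rs rt cv').
rewrite qpochs_inf5 in rhs_den1; rewrite qpochs_inf2 in rhs_den2.
rewrite (@mixed_base_product R q q_neq0 q1 a c s t) // in S.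
rewrite !qpochs_inf5 !qpochs_inf2.
move: S; congr (bilateral_sum _ _); apply/funext => n; symmetry.
exact: (@mixed_base_summand R q q_neq0 a c s t n).
Qed.
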